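(* Let $q>2$ and $L>0$. Then the discrete tangent-point energies $\mathcal{E}_q^n$ $\Gamma$-converge, as $n\to\infty$, to the tangent-point energy $\mathrm{TP}_q$ on the metric space $\left(C^1_{\mathrm{ia}}(\mathbb{R}/L\mathbb{Z},\mathbb{R}^3),\|\cdot\|_{C^1}\right)$.
   Context: $C^1_{\mathrm{ia}}(\mathbb{R}/L\mathbb{Z},\mathbb{R}^3)$ is the set of closed $C^1$-curves $\gamma:\mathbb{R}/L\mathbb{Z}\to\mathbb{R}^3$ that are injective and parametrized by arclength ($|\gamma'|\equiv 1$, so the length is $L$), with the metric induced by the $C^1$-norm. Tangent-point energy: for an arclength parametrized $\gamma$ on $\mathbb{R}/L\mathbb{Z}$, $$\mathrm{TP}_q(\gamma)=\iint_{(\mathbb{R}/L\mathbb{Z})^2}\left(\frac{2\,\mathrm{dist}(\gamma(s)+\mathbb{R}\gamma'(s),\gamma(t))}{|\gamma(s)-\gamma(t)|^2}\right)^q ds\,dt\in[0,\infty].$$ Biarcs: a biarc is a pair of circular arcs in $\mathbb{R}^3$ (straight segments allowed as degenerate arcs), joined continuously with continuous tangent, interpolating a point-tangent pair $([q_0,t_0],[q_1,t_1])$ with $q_0,q_1\in\mathbb{R}^3$, $q_0\ne q_1$, and unit vectors $t_0,t_1\in\mathbb{S}^2$: it runs from $q_0$ with tangent $t_0$ to $q_1$ with tangent $t_1$ (with orientation). A closed biarc curve consisting of $n$ biarcs is a closed curve assembled in a $C^1$-fashion from $n$ consecutive biarcs interpolating data $[q_0,t_0],\dots,[q_n,t_n]$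 with $[q_n,t_n]=[q_0,t_0]$, where the $i$-th biarc ($i=0,\dots,n-1$) interpolates $([q_i,t_i],[q_{i+1},t_{i+1}])$ and has length $\lambda_i$. A biarc curve is understood together with its decomposition into biarcs; the points $q_i$ and unit tangents $t_i$ are those at the junctions of consecutive biarcs. Let $\mathcal{B}_n$ be the class of closed biarc curves $\beta$ consisting of $n$ biarcs such that, with $\mathscr{L}(\beta)$ the length of $\beta$, $$\frac{\mathscr{L}(\beta)}{2n}\le\lambda_i\le\frac{2\mathscr{L}(\beta)}{n}\quad\text{for } i=0,\dots,n-1 .$$ Discrete tangent-point energy (parameter invariant): for $n\in\mathbb{N}$, $q\in[2,\infty)$ and a closed $C^1$-curve $\gamma$, $$\mathcal{E}_q^n(\gamma)=\sum_{i=0}^{n-1}\sum_{j=0,\,j\ne i}^{n-1}\left(\frac{2\,\mathrm{dist}(l(q_j),q_i)}{|q_i-q_j|^2}\right)^q\lambda_i\lambda_j\ \text{ if }\gamma\in\mathcal{B}_n,\qquad \mathcal{E}_q^n(\gamma)=\infty\ \text{ otherwise},$$ where $l(q_j)=q_j+\mathbb{R}t_j$. $\Gamma$-convergence of $\mathcal{F}_n$ to $\mathcal{F}$ on a metric space $X$ means: (liminf) for all $x_n\to x$ in $X$, $\mathcal{F}(x)\le\liminf_{n\to\infty}\mathcal{F}_n(x_n)$; (limsup) for every $x\in X$ there is a sequence $x_n\to x$ in $X$ with $\limsup_{n\to\infty}\mathcal{F}_n(x_n)\le\mathcal{F}(x)$. *)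

(* Defs.v *)
From HB Require Import structures.
From mathcomp Require Import all_boot all_order all_algebra.
From mathcomp Require Import all_classical all_reals all_analysis.
From mathcomp Require Import ring lra.

Set Implicit Arguments.
Unset Strict Implicit.
Unset Printing Implicit Defensive.

Import Order.TTheory GRing.Theory Num.Theory.
Import numFieldNormedType.Exports.

Local Open Scope classical_set_scope.
Local Open Scope ring_scope.

(* The library norm of 'rV[R]_3 is the sup norm; it is used below only through
   the topology (derivatives, continuity), where the choice is irrelevant.  All
   metric quantities use the Euclidean norm [enorm]. *)
Definition dotv (R : realType) (u v : 'rV[R]_3) : R := \sum_i u 0 i * v 0 i.

Definition enorm (R : realType) (u : 'rV[R]_3) : R := Num.sqrt (dotv u u).

Definition dist_line (R : realType) (p t x : 'rV[R]_3) : R :=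
  inf (range (fun r : R => enorm (x - (p + r *: t)))).

(* 2 dist(p + R t, x) / |p - x|^2; its value at x = p is 0 (division by 0),
   which only concerns the diagonal, a null set in [TP] and excluded from
   [discrete_sum]. *)
Definition tp_quotient (R : realType) (p t x : 'rV[R]_3) : R :=
  2 * dist_line p t x / enorm (p - x) ^+ 2.

(* Functions on R/LZ are represented by L-periodic functions on R. *)
Record C1ia (R : realType) (L : {posnum R}) := MkC1ia {
  curve_fun :> R -> 'rV[R]_3 ;
  curve_periodic : forall s, curve_fun (s + L%:num) = curve_fun s ;
  curve_derivable : forall s, derivable curve_fun s 1 ;
  curve_continuous_derive : continuous (derive1 curve_fun) ;
  curve_arclength : forall s, enorm (derive1 curve_fun s) = 1 ;
  curve_injective : forall s t, curve_fun s = curve_fun t ->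
    exists k : int, s - t = k%:~R * L%:num
}.

Definition C1norm (R : realType) (f : R -> 'rV[R]_3) : R :=
  sup (range (fun s => enorm (f s))) + sup (range (fun s => enorm (derive1 f s))).

Definition C1dist (R : realType) (L : {posnum R}) (g h : C1ia L) : R :=
  C1norm (fun s => g s - h s).

Lemma dotvDl (R : realType) (u v w : 'rV[R]_3) :
  dotv (u + v) w = dotv u w + dotv v w.
Proof.
by rewrite /dotv -big_split/=; apply: eq_bigr => i _; rewrite mxE mulrDl.
Qed.

Lemma dotv_ge0 (R : realType) (u : 'rV[R]_3) : 0 <= dotv u u.
Proof. by rewrite /dotv sumr_ge0// => i _; rewrite -expr2 sqr_ge0. Qed.

Lemma enorm_ge0 (R : realType) (u : 'rV[R]_3) : 0 <= enorm u.
Proof. exact: sqrtr_ge0. Qed.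

Lemma enorm0 (R : realType) : enorm (0 : 'rV[R]_3) = 0.
Proof.
by rewrite /enorm /dotv big1 ?sqrtr0// => i _; rewrite mxE mul0r.
Qed.

Lemma enorm_eq0 (R : realType) (u : 'rV[R]_3) : enorm u = 0 -> u = 0.
Proof.
move=> /eqP; rewrite sqrtr_eq0 => u0.
have /eqP : dotv u u = 0 by apply/le_anti; rewrite u0 dotv_ge0.
rewrite psumr_eq0; last by move=> i _; rewrite -expr2 sqr_ge0.
move=> /allP h; apply/rowP => i; rewrite mxE.
by have := h i (mem_index_enum _); rewrite /= -expr2 sqrf_eq0 => /eqP.
Qed.

Lemma enormN (R : realType) (u : 'rV[R]_3) : enorm (- u) = enorm u.
Proof.
by congr Num.sqrt; apply: eq_bigr => i _; rewrite mxE mulrNN.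
Qed.

Lemma dotv_le_enorm (R : realType) (u v : 'rV[R]_3) :
  dotv u v <= enorm u * enorm v.
Proof.
rewrite (le_trans (ler_norm _))// -sqrtr_sqr /enorm -sqrtrM ?dotv_ge0//.
apply: ler_wsqrtr; rewrite /dotv !big_ord_recr !big_ord0/= !add0r.
move: (u 0 _) (u 0 _) (u 0 _) (v 0 _) (v 0 _) (v 0 _) => a b c x y z.
have : 0 <= (a * y - b * x) ^+ 2 + (a * z - c * x) ^+ 2 + (b * z - c * y) ^+ 2.
  by rewrite !addr_ge0// sqr_ge0.
lra.
Qed.

Lemma ler_enormD (R : realType) (u v : 'rV[R]_3) :
  enorm (u + v) <= enorm u + enorm v.
Proof.
rewrite -(@ler_pXn2r _ 2)// ?nnegrE ?addr_ge0 ?enorm_ge0//.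
have E w : enorm w ^+ 2 = dotv w w by rewrite sqr_sqrtr// dotv_ge0.
have C : dotv v u = dotv u v by apply: eq_bigr => i _; rewrite mulrC.
have D : dotv (u + v) (u + v) = dotv u u + 2 * dotv u v + dotv v v.
  rewrite dotvDl.
  have -> : dotv u (u + v) = dotv (u + v) u.
    by apply: eq_bigr => i _; rewrite mulrC.
  have -> : dotv v (u + v) = dotv (u + v) v.
    by apply: eq_bigr => i _; rewrite mulrC.
  by rewrite !dotvDl C; ring.
rewrite sqrrD !E D; have := dotv_le_enorm u v; lra.
Qed.

Lemma continuous_enorm (R : realType) (f : R -> 'rV[R]_3) :
  continuous f -> continuous (fun s => enorm (f s)).
Proof.
move=> cf s; apply: (@continuous_comp _ _ _ (fun s => dotv (f s) (f s))).
  rewrite /dotv; apply: cvg_big => [|i _]; first exact: add_continuous.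
  have cfi : f t 0 i @[t --> s] --> f s 0 i.
    apply: (@continuous_comp _ _ _ f (fun u : 'rV[R]_3 => u 0 i)).
      exact: cf.
    exact: coord_continuous.
  exact: cvgM.
exact: sqrt_continuous.
Qed.

Lemma has_sup_periodic (R : realType) (L : {posnum R}) (f : R -> R) :
  (forall s, f (s + L%:num) = f s) -> continuous f -> has_sup (range f).
Proof.
move=> pf cf; split; first by exists (f 0), 0.
have [c _ fc] := @EVT_max R f 0 L%:num (ltW [gt0 of L%:num])
  (continuous_subspaceT cf).
exists (f c) => _ [s _ <-].
have pfn (n : nat) t : f (t + L%:num *+ n) = f t.
  by elim: n => [|n IH]; rewrite ?addr0// mulrSr addrA pf IH.
have pfz (k : int) t : f (t + k%:~R * L%:num) = f t.
  case: k => n; first by rewrite mulr_natl pfn.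
  rewrite NegzE mulrNz mulNr -[RHS](congr1 f (subrK (L%:num *+ n.+1) t)) pfn.
  by rewrite mulr_natl.
set k := Num.floor (s / L%:num).
rewrite -(pfz (- k) s); apply: fc.
rewrite in_itv/= mulrNz mulNr subr_ge0 -ler_pdivlMr// floor_le/=.
rewrite lerBlDr -[X in X + _]mul1r -mulrDl -ler_pdivrMr// ltW//.
by have := floorD1_gt (s / L%:num); rewrite intrD addrC.
Qed.

Lemma derive1_periodic (R : realType) (L : R) (f : R -> 'rV[R]_3) :
  (forall s, f (s + L) = f s) -> forall s, derive1 f (s + L) = derive1 f s.
Proof.
by move=> pf s; rewrite /derive1; under eq_fun do rewrite /= addrA !pf.
Qed.

Lemma derive1_subC1ia (R : realType) (L : {posnum R}) (g h : C1ia L) :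
  derive1 (fun s => g s - h s) = (fun s => derive1 g s - derive1 h s).
Proof.
by apply/funext => s; rewrite !derive1E; apply: deriveB; exact: curve_derivable.
Qed.

Lemma C1ia_continuous (R : realType) (L : {posnum R}) (g : C1ia L) :
  continuous g.
Proof.
move=> s; apply: differentiable_continuous; apply/derivable1_diffP.
exact: curve_derivable.
Qed.

Lemma has_sup_subC1ia (R : realType) (L : {posnum R}) (g h : C1ia L) :
  has_sup (range (fun s => enorm (g s - h s))).
Proof.
apply: (@has_sup_periodic _ L) => [s|]; first by rewrite !curve_periodic.
by apply: continuous_enorm => s; apply: cvgB; exact: C1ia_continuous.
Qed.

Lemma has_sup_derive1_subC1ia (R : realType) (L : {posnum R}) (g h : C1ia L) :
  has_sup (range (fun s => enorm (derive1 g s - derive1 h s))).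
Proof.
apply: (@has_sup_periodic _ L) => [s|].
  by rewrite !(derive1_periodic (@curve_periodic _ _ _)).
by apply: continuous_enorm => s; apply: cvgB; exact: curve_continuous_derive.
Qed.

Lemma C1distE (R : realType) (L : {posnum R}) (g h : C1ia L) :
  C1dist g h = sup (range (fun s => enorm (g s - h s))) +
               sup (range (fun s => enorm (derive1 g s - derive1 h s))).
Proof. by rewrite /C1dist /C1norm derive1_subC1ia. Qed.

Lemma C1dist_refl (R : realType) (L : {posnum R}) (g : C1ia L) :
  C1dist g g = 0.
Proof.
have E (f : R -> 'rV[R]_3) : sup (range (fun s => enorm (f s - f s))) = 0.
  rewrite (_ : range (fun s => enorm (f s - f s)) = [set 0]) ?sup1//.
  apply/seteqP; split => [_ [s _ <-]|_ ->]; first by rewrite /= subrr enorm0.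
  by exists 0 => //; rewrite subrr enorm0.
by rewrite C1distE !E addr0.
Qed.

Lemma C1dist_sym (R : realType) (L : {posnum R}) (g h : C1ia L) :
  C1dist g h = C1dist h g.
Proof.
rewrite !C1distE; congr (sup _ + sup _); apply: eq_imagel => s _;
  by rewrite -enormN opprB.
Qed.

Lemma C1dist_triangle (R : realType) (L : {posnum R}) (h g k : C1ia L) :
  C1dist g k <= C1dist g h + C1dist h k.
Proof.
have T (f1 f2 f3 : R -> 'rV[R]_3) :
    has_sup (range (fun s => enorm (f1 s - f2 s))) ->
    has_sup (range (fun s => enorm (f2 s - f3 s))) ->
    sup (range (fun s => enorm (f1 s - f3 s))) <=
    sup (range (fun s => enorm (f1 s - f2 s))) +
    sup (range (fun s => enorm (f2 s - f3 s))).
  move=> [_ s12] [_ s23]; apply: ge_sup; first by exists (enorm (f1 0 - f3 0)), 0.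
  move=> _ [s _ <-]; rewrite -(subrKA (f2 s)) (le_trans (ler_enormD _ _))//.
  by apply: lerD; apply: ub_le_sup => //; exists s.
rewrite !C1distE addrACA lerD// T//;
  [exact: has_sup_subC1ia..|exact: has_sup_derive1_subC1ia|
   exact: has_sup_derive1_subC1ia].
Qed.

Lemma C1dist_eq0 (R : realType) (L : {posnum R}) (g h : C1ia L) :
  C1dist g h = 0 -> g = h.
Proof.
rewrite C1distE => d0.
have [_ s1] := has_sup_subC1ia g h; have [_ s2] := has_sup_derive1_subC1ia g h.
have gh : curve_fun g = curve_fun h.
  apply/funext => s; apply/eqP; rewrite -subr_eq0; apply/eqP/enorm_eq0.
  have le1 : enorm (g s - h s) <= sup (range (fun s => enorm (g s - h s))).
    by apply: ub_le_sup => //; exists s.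
  have le2 : enorm (derive1 g s - derive1 h s) <=
      sup (range (fun s => enorm (derive1 g s - derive1 h s))).
    by apply: ub_le_sup => //; exists s.
  have := enorm_ge0 (g s - h s); have := enorm_ge0 (derive1 g s - derive1 h s).
  lra.
case: g h gh {d0 s1 s2} => [g g1 g2 g3 g4 g5] [h h1 h2 h3 h4 h5] /= gh.
by subst h; congr MkC1ia; exact: Prop_irrelevance.
Qed.

HB.instance Definition _ (R : realType) (L : {posnum R}) :=
  gen_eqMixin (C1ia L).
HB.instance Definition _ (R : realType) (L : {posnum R}) :=
  gen_choiceMixin (C1ia L).
HB.instance Definition _ (R : realType) (L : {posnum R}) :=
  @isMetric.Build R (C1ia L) (@C1dist R L) (@C1dist_refl R L)
    (@C1dist_eq0 R L) (@C1dist_sym R L) (@C1dist_triangle R L).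

Definition TP (R : realType) (q : R) (L : {posnum R}) (g : C1ia L) : \bar R :=
  (\int[(@lebesgue_measure R \x @lebesgue_measure R)]_(z in
      `[0%R, L%:num[ `*` `[0%R, L%:num[)
    ((tp_quotient (g z.1) (derive1 g z.1) (g z.2)) `^ q)%:E)%E.

(* The restriction of f to [a, b] is a unit speed parametrization of a straight
   segment or of an arc of the circle with centre c and radius r in the plane
   c + span(u, v). *)
Definition circular_arc (R : realType) (f : R -> 'rV[R]_3) (a b : R) : Prop :=
  (exists p u : 'rV[R]_3, enorm u = 1 /\
     forall s, a <= s <= b -> f s = p + (s - a) *: u) \/
  (exists (c u v : 'rV[R]_3) (r : R),
     [/\ 0 < r, b - a <= 2 * pi * r,
         [/\ enorm u = 1, enorm v = 1 & dotv u v = 0] &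
         forall s, a <= s <= b ->
           f s = c + (r * cos ((s - a) / r)) *: u
                   + (r * sin ((s - a) / r)) *: v]).

(* [biarc f a b]: f restricted to [a, b] is a biarc, of length b - a, with
   matching point f m.  The interpolated data are [f a, f' a], [f b, f' b].
   It is only applied to curves f that are C^1 on R, so that the tangents of
   consecutive arcs agree. *)
Definition biarc (R : realType) (f : R -> 'rV[R]_3) (a b : R) : Prop :=
  f a <> f b /\
  exists m, [/\ a < m < b, circular_arc f a m & circular_arc f m b].

(* [s 0 < ... < s n = s 0 + L] are the junction parameters of a decomposition
   of g into n biarcs; the values [s i] for i > n are irrelevant. The points,
   tangents and lengths of the paper are
     q_i = g (s i),  t_i = derive1 g (s i),  lambda_i = s i.+1 - s i.
   The base point g (s 0) need not be g 0. *)
Definition biarc_decomposition (R : realType) (L : {posnum R}) (n : nat)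
    (g : C1ia L) (s : nat -> R) : Prop :=
  s n = s 0 + L%:num /\ forall i, (i < n)%N -> biarc g (s i) (s i.+1).

Definition biarc_length (R : realType) (s : nat -> R) (i : nat) : R :=
  s i.+1 - s i.

(* g together with the decomposition s belongs to B_n *)
Definition in_B (R : realType) (L : {posnum R}) (n : nat) (g : C1ia L)
    (s : nat -> R) : Prop :=
  biarc_decomposition n g s /\
  forall i, (i < n)%N ->
    L%:num / (2 * n%:R) <= biarc_length s i <= 2 * L%:num / n%:R.

Definition discrete_sum (R : realType) (q : R) (L : {posnum R}) (n : nat)
    (g : C1ia L) (s : nat -> R) : R :=
  \sum_(i < n) \sum_(j < n | j != i)
    (tp_quotient (g (s j)) (derive1 g (s j)) (g (s i))) `^ q
      * biarc_length s i * biarc_length s j.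

(* A curve may be decomposed into n biarcs in several ways, and the discrete
   energy depends on the decomposition.  As a function of the curve alone it is
   the infimum over all admissible decompositions; ereal_inf set0 = +oo gives
   the value outside B_n.  For Gamma-convergence this amounts to letting every
   curve of a sequence carry a decomposition: the liminf inequality is required
   for all of them, the limsup inequality for a suitable one. *)
Definition discrete_TP (R : realType) (q : R) (L : {posnum R}) (n : nat)
    (g : C1ia L) : \bar R :=
  ereal_inf [set (discrete_sum q n g s)%:E | s in in_B n g].

Definition Gamma_converges (R : realType) (X : metricType R)
    (F_ : nat -> X -> \bar R) (F : X -> \bar R) : Prop :=
  (forall (x_ : nat -> X) (x : X), x_ @ \oo --> x ->
     (F x <= limn_einf (fun n => F_ n (x_ n)))%E) /\
  (forall x : X, exists x_ : nat -> X, x_ @ \oo --> x /\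
     (limn_esup (fun n => F_ n (x_ n)) <= F x)%E).

(* Main.v *)
Require Import Defs.
From HB Require Import structures.
From mathcomp Require Import all_boot all_order all_algebra.
From mathcomp Require Import all_classical all_reals all_analysis measurable_realfun.
From mathcomp Require Import ring lra zify ssrAC.

Set Implicit Arguments.
Unset Strict Implicit.
Unset Printing Implicit Defensive.

Import Order.TTheory GRing.Theory Num.Theory.
Import numFieldNormedType.Exports.

Local Open Scope classical_set_scope.
Local Open Scope ring_scope.

(** Liminf: a decomposition into biarcs cuts R/LZ x R/LZ into rectangles, and
    the discrete energy is the integral of a step function on them.  These step
    functions converge pointwise to the tangent-point integrand, which vanishes
    on the diagonal, so Fatou's lemma applies.

    Limsup: interpolating the point-tangent data of a curve at nearly
    equidistant parameters by biarcs, and rescaling to length L, gives an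
    injective C^1-close curve whose discrete energy is at most 1 + eps times a
    Riemann sum of the integrand at these parameters.  No regularity beyond C^1
    is used: the integrand is split by a cutoff into a part away from the
    diagonal, which is bounded and continuous, so that its Riemann sums
    converge, and a part near the diagonal of small integral.  An averaging
    argument selects parameters for which the sum of the latter is bounded by a
    constant times its integral. *)

(** * Euclidean geometry of the tangent-point quotient *)

Section euclidean.
Context {R : realType}.
Implicit Types (u v w p t x : 'rV[R]_3) (k a b : R).

(** Finite energy controls the integrand near the diagonal only in the mean, so the near part of a
    sum over prescribed, say equidistant, samples need not be small. Hence each parameter is left
    free in the first quarter of one of n equal intervals of length h. The mean of the near sum over
    these choices is at most a multiple of its integral, and consecutive parameters still differ by
    3h/4 to 5h/4, well inside the bounds h/2 and 2h required of biarc lengths. The interpolating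
    curve carries at its junctions the tangents of the given curve, and its points up to one common
    factor c. The energies are thus compared term by term, and only the biarc lengths and c enter
    the error; both are controlled by the modulus of continuity of the tangent. The factor c
    restores the length L at the price of moving the junction parameters, but relative errors of
    lengths add up to a relative error, so this drift is small. *)

Lemma dotv3E u v (i := lift ord0 ord0 : 'I_3) (j := lift ord0 (lift ord0 ord0) : 'I_3) :
  dotv u v = u 0 ord0 * v 0 ord0 + u 0 i * v 0 i + u 0 j * v 0 j.
Proof. by rewrite /dotv !big_ord_recl big_ord0 addr0 addrA. Qed.

Lemma dotvC u v : dotv u v = dotv v u.
Proof. by apply: eq_bigr => i _; rewrite mulrC. Qed.

Lemma dotvDr u v w : dotv w (u + v) = dotv w u + dotv w v.
Proof. by rewrite dotvC dotvDl !(dotvC w). Qed.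

Lemma dotvZl k u v : dotv (k *: u) v = k * dotv u v.
Proof. by rewrite !dotv3E !mxE; ring. Qed.

Lemma dotvZr k u v : dotv u (k *: v) = k * dotv u v.
Proof. by rewrite dotvC dotvZl dotvC. Qed.

Lemma dotvNl u v : dotv (- u) v = - dotv u v.
Proof. by rewrite -scaleN1r dotvZl mulN1r. Qed.

Lemma dotvNr u v : dotv u (- v) = - dotv u v.
Proof. by rewrite dotvC dotvNl dotvC. Qed.

Lemma dotvBl u v w : dotv (u - v) w = dotv u w - dotv v w.
Proof. by rewrite dotvDl dotvNl. Qed.

Lemma dotvBr u v w : dotv w (u - v) = dotv w u - dotv w v.
Proof. by rewrite dotvDr dotvNr. Qed.

Lemma enorm_sqr u : enorm u ^+ 2 = dotv u u.
Proof. by rewrite sqr_sqrtr// dotv_ge0. Qed.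

Lemma enormZ k u : enorm (k *: u) = `|k| * enorm u.
Proof.
by rewrite /enorm dotvZl dotvZr mulrA -expr2 sqrtrM ?sqr_ge0// sqrtr_sqr.
Qed.

Lemma enormB u v : enorm (u - v) = enorm (v - u).
Proof. by rewrite -enormN opprB. Qed.

Lemma enorm_gt0 u : u <> 0 -> 0 < enorm u.
Proof.
move=> u0; rewrite lt_neqAle enorm_ge0 andbT eq_sym.
by apply/eqP => /enorm_eq0.
Qed.

Lemma ler_enormB u v w : enorm (u - v) <= enorm (u - w) + enorm (w - v).
Proof. by rewrite -(subrKA w); exact: ler_enormD. Qed.

Lemma ler_dist_enorm u v : `|enorm u - enorm v| <= enorm (u - v).
Proof.
rewrite ler_norml; apply/andP; split.
  by rewrite lerNl opprB lerBlDr enormB -{1}(subrK u v) ler_enormD.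
by rewrite lerBlDr -{1}(subrK v u) ler_enormD.
Qed.

Lemma norm_dotv_le u v : `|dotv u v| <= enorm u * enorm v.
Proof.
rewrite ler_norml dotv_le_enorm andbT lerNl -dotvNl -(enormN u).
exact: dotv_le_enorm.
Qed.

Lemma enorm_le_sqr u a : 0 <= a -> dotv u u <= a ^+ 2 -> enorm u <= a.
Proof. by move=> a0; rewrite -enorm_sqr ler_pXn2r// nnegrE enorm_ge0. Qed.

Lemma enorm_eq1 u : dotv u u = 1 -> enorm u = 1.
Proof. by rewrite /enorm => ->; rewrite sqrtr1. Qed.

Lemma dotv_eq1 u : enorm u = 1 -> dotv u u = 1.
Proof. by rewrite -enorm_sqr => ->; rewrite expr1n. Qed.

Lemma coord_le_enorm u i : `|u 0 i| <= enorm u.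
Proof.
rewrite -sqrtr_sqr /enorm ler_wsqrtr// /dotv (bigD1 i)//= expr2 lerDl.
by rewrite sumr_ge0// => j _; rewrite -expr2 sqr_ge0.
Qed.

(** The bridge from Euclidean estimates to the topology of ['rV[R]_3], which comes from the sup
    norm; [enorm_cvg] needs this direction only. *)
Lemma norm_le_enorm u : `|u| <= enorm u.
Proof.
rewrite /Num.Def.normr/= mx_normrE bigmax_le ?enorm_ge0// => -[i j] _ /=.
by rewrite ord1; exact: coord_le_enorm.
Qed.

Lemma cvg_dotv T (F : set_system T) {FF : ProperFilter F}
    (u_ v_ : T -> 'rV[R]_3) u v :
  u_ @ F --> u -> v_ @ F --> v -> dotv (u_ z) (v_ z) @[z --> F] --> dotv u v.
Proof.
move=> cu cv; rewrite /dotv; apply: cvg_big => [|i _]; first exact: add_continuous.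
have cc w : w' 0 i @[w' --> w] --> (w 0 i : R) by exact: coord_continuous.
by apply: cvgM; [exact: (cvg_comp _ _ cu (cc u))|exact: (cvg_comp _ _ cv (cc v))].
Qed.

Lemma cvg_enorm T (F : set_system T) {FF : ProperFilter F}
    (u_ : T -> 'rV[R]_3) u :
  u_ @ F --> u -> enorm (u_ z) @[z --> F] --> enorm u.
Proof.
move=> cu.
exact: (cvg_comp _ _ (cvg_dotv cu cu) (@sqrt_continuous R _)).
Qed.

Lemma enorm_cvg T (F : set_system T) {FF : Filter F}
    (u_ : T -> 'rV[R]_3) u :
  (forall e, 0 < e -> \forall z \near F, enorm (u_ z - u) <= e) ->
  u_ @ F --> u.
Proof.
move=> H; apply/cvgrPdist_le => e e0; near=> z.
rewrite distrC (le_trans (norm_le_enorm _))//.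
by near: z; exact: H.
Unshelve. all: by end_near. Qed.

(** Pythagoras: for [w = x - p], |w - r t|^2 is |w|^2 - (w.t)^2 plus (r - w.t)^2, so the infimum is
    attained at the orthogonal projection. The closed form gives access to continuity and
    measurability of the quotient. *)
Lemma dist_lineE p t x : enorm t = 1 ->
  dist_line p t x = Num.sqrt (dotv (x - p) (x - p) - dotv (x - p) t ^+ 2).
Proof.
move=> /dotv_eq1 t1.
have E0 w r : enorm (w - r *: t) =
    Num.sqrt (dotv w w - dotv w t ^+ 2 + (r - dotv w t) ^+ 2).
  rewrite /enorm; congr Num.sqrt.
  by rewrite dotvBl !dotvBr !dotvZl !dotvZr t1 (dotvC t); ring.
have E r : enorm (x - (p + r *: t)) =
    Num.sqrt (dotv (x - p) (x - p) - dotv (x - p) t ^+ 2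
              + (r - dotv (x - p) t) ^+ 2) by rewrite opprD addrA E0.
apply/le_anti/andP; split.
  apply: (@le_trans _ _ (enorm (x - (p + dotv (x - p) t *: t)))).
    apply: ge_inf; last by exists (dotv (x - p) t).
    by exists 0 => _ [r _ <-]; exact: enorm_ge0.
  by rewrite E subrr expr0n/= addr0.
apply: lb_le_inf; first by exists (enorm (x - (p + 0 *: t))), 0.
by move=> _ [r _ <-]; rewrite E ler_wsqrtr// lerDl sqr_ge0.
Qed.

Lemma tp_quotientE p t x : enorm t = 1 -> tp_quotient p t x =
  2 * Num.sqrt (dotv (x - p) (x - p) - dotv (x - p) t ^+ 2)
    / dotv (x - p) (x - p).
Proof. by move=> t1; rewrite /tp_quotient dist_lineE// enormB enorm_sqr. Qed.

Lemma tp_quotient_ge0 p t x : enorm t = 1 -> 0 <= tp_quotient p t x.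
Proof.
by move=> t1; rewrite tp_quotientE// divr_ge0 ?dotv_ge0// mulr_ge0// sqrtr_ge0.
Qed.

Lemma tp_quotient_diag p t : tp_quotient p t p = 0.
Proof. by rewrite /tp_quotient subrr enorm0 expr0n invr0 mulr0. Qed.

(** The line passes through [p], so its distance from [x] is at most |p - x|; the quotient can be
    large only for short chords. *)
Lemma tp_quotient_le p t x : enorm t = 1 -> tp_quotient p t x <= 2 / enorm (p - x).
Proof.
move=> t1; rewrite tp_quotientE// -enorm_sqr enormB.
have [->|n0] := eqVneq (enorm (p - x)) 0.
  by rewrite expr0n/= !invr0 !mulr0.
have np : 0 < enorm (p - x) by rewrite lt_neqAle eq_sym n0 enorm_ge0.
rewrite expr2 invfM mulrA ler_pM2r ?invr_gt0// ler_pdivrMr// ler_pM2l//.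
rewrite -expr2 -[leRHS]ger0_norm ?enorm_ge0// -sqrtr_sqr ler_wsqrtr//.
by rewrite lerBlDr lerDl sqr_ge0.
Qed.

(** The quotient is an inverse length: the distance scales with [k], the squared chord with
    [k ^+ 2], the direction [t] not at all. *)
Lemma tp_quotientZ k p t x : 0 < k -> enorm t = 1 ->
  tp_quotient (k *: p) t (k *: x) = tp_quotient p t x / k.
Proof.
move=> k0 t1; rewrite !tp_quotientE// -scalerBr !dotvZl dotvZr.
set A := dotv _ _; set B := dotv _ t.
have -> : k * (k * A) - (k * B) ^+ 2 = k ^+ 2 * (A - B ^+ 2) by ring.
rewrite sqrtrM ?sqr_ge0// sqrtr_sqr gtr0_norm// !invfM.
have [->|A0] := eqVneq A 0; first by rewrite invr0 !(mulr0, mul0r).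
by field; rewrite A0 gt_eqF.
Qed.

Lemma cvg_tp_quotient T (F : set_system T) {FF : ProperFilter F}
    (p_ t_ x_ : T -> 'rV[R]_3) p t x :
  p <> x -> enorm t = 1 -> (forall z, enorm (t_ z) = 1) ->
  p_ @ F --> p -> t_ @ F --> t -> x_ @ F --> x ->
  tp_quotient (p_ z) (t_ z) (x_ z) @[z --> F] --> tp_quotient p t x.
Proof.
move=> px t1 t_1 pp tt xx; rewrite tp_quotientE//.
under eq_fun do rewrite tp_quotientE//.
have ww : x_ z - p_ z @[z --> F] --> x - p by exact: cvgB.
have dd : dotv (x_ z - p_ z) (x_ z - p_ z) @[z --> F] --> dotv (x - p) (x - p).
  exact: cvg_dotv.
apply: cvgM; last first.
  apply: (cvgV _ dd); rewrite -enorm_sqr expf_neq0// gt_eqF// enorm_gt0//.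
  by move/eqP; rewrite subr_eq0 eq_sym => /eqP.
apply: cvgM; first exact: cvg_cst.
have df : dotv (x_ z - p_ z) (x_ z - p_ z) - dotv (x_ z - p_ z) (t_ z) ^+ 2
    @[z --> F] --> dotv (x - p) (x - p) - dotv (x - p) t ^+ 2.
  apply: cvgB => //; rewrite expr2; under eq_fun do rewrite expr2.
  by apply: cvgM; exact: cvg_dotv.
exact: (cvg_comp _ _ df (@sqrt_continuous R _)).
Qed.

End euclidean.

(** * Curves with a prescribed continuous tangent, and their gluing *)

Section tangent.
Context {R : realType}.
Implicit Types (T : R -> 'rV[R]_3) (u v w p : 'rV[R]_3) (s a b c e : R).

Lemma is_deriveP (V : normedModType R) (f : R -> V) s (d : V) :
  is_derive s 1 f d <-> h^-1 *: (f (h + s) - f s) @[h --> 0^'] --> d.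
Proof.
have E : (fun h => h^-1 *: (f (h + s) - f s)) =
         (fun h => h^-1 *: ((f \o shift s) (h *: 1) - f s)).
  by apply/funext => h /=; rewrite -[h *: 1]/(h * 1) mulr1.
split => [[df <-]|]; first by rewrite E; exact: df.
rewrite E => h; split; first by apply/cvg_ex; exists d.
exact: cvg_lim h.
Qed.

Lemma is_derive_rV (f : R -> 'rV[R]_3) s (d : 'rV[R]_3) :
  (forall i, is_derive s 1 (fun x => f x 0 i) (d 0 i)) -> is_derive s 1 f d.
Proof.
move=> H; have df : derivable f s 1.
  by apply/derivable_mxP => i j; rewrite ord1; have [] := H j.
split=> //; rewrite derive_mx//; apply/rowP => i; rewrite mxE.
by have [] := H i.
Qed.

Lemma is_derive_coord (f : R -> 'rV[R]_3) s d i :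
  is_derive s 1 f d -> is_derive s 1 (fun x => f x 0 i) (d 0 i).
Proof.
move=> [df fd]; split; first by have /derivable_mxP := df; exact.
by rewrite -fd derive_mx// mxE.
Qed.

Lemma is_derive_mulr (f : R -> R) s d c :
  is_derive s 1 f d -> is_derive s 1 (fun x => f x * c) (d * c).
Proof.
move=> H; have h := @is_deriveM R _ f (cst c) s 1 _ _ H (is_derive_cst _ _ _).
have -> : d * c = f s *: 0 + c *: d by rewrite scaler0 add0r mulrC.
exact: h.
Qed.

Lemma is_derive_dotv (f : R -> 'rV[R]_3) s d u :
  is_derive s 1 f d -> is_derive s 1 (fun x => dotv (f x) u) (dotv d u).
Proof.
move=> H; rewrite (_ : (fun x => _) = \sum_i (fun x => f x 0 i * u 0 i)); last first.
  by apply/funext => x; rewrite fct_sumE.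
apply: is_derive_sum => i.
exact: is_derive_mulr (is_derive_coord i H).
Qed.

(** Keeps the tangent as explicit data: for curves pieced together [T] is known in advance, and
    [derive1] is recovered only at the end. *)
Definition tangent_field (f : R -> 'rV[R]_3) T := (forall s, is_derive s 1 f (T s)) /\ continuous T.

Lemma tangent_field_derive1 f T : tangent_field f T -> derive1 f = T.
Proof. by move=> [H _]; apply/funext => s; rewrite derive1E; case: (H s). Qed.

Lemma tangent_field_C1ia (L : {posnum R}) (g : C1ia L) :
  tangent_field g (derive1 g).
Proof.
split=> [s|]; last exact: curve_continuous_derive.
by rewrite derive1E; apply: DeriveDef => //; exact: curve_derivable.
Qed.

Lemma tangent_field_continuous f T : tangent_field f T -> continuous f.
Proof.
move=> [H _] s; apply: differentiable_continuous; apply/derivable1_diffP.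
by case: (H s).
Qed.

(** The mean value theorem is scalar, so the deviation D of the chord is paired with itself: the
    function (f s - s w).D has derivative (T s - w).D, which is at most e |D|. *)
Lemma tangent_field_chord f T a b w e : tangent_field f T -> a <= b ->
  (forall s, a <= s <= b -> enorm (T s - w) <= e) ->
  enorm (f b - f a - (b - a) *: w) <= e * (b - a).
Proof.
move=> fT ab Te; set D := _ - _ - _.
have [D0|/eqP/enorm_gt0 D0] := eqVneq D 0.
  rewrite D0 enorm0 mulr_ge0 ?subr_ge0//.
  by rewrite (le_trans (enorm_ge0 _) (Te a _))// lexx.
rewrite -(ler_pM2r D0) -expr2 enorm_sqr.
have df s : is_derive s 1 (fun s => dotv (f s) D - s * dotv w D) (dotv (T s - w) D).
  have h1 := is_derive_dotv D (fT.1 s).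
  have h2 : is_derive s 1 (fun s => s * dotv w D) (dotv w D).
    by rewrite -[X in is_derive _ _ _ X]mul1r; apply: is_derive_mulr.
  by rewrite dotvBl; exact: is_deriveB.
have [|c cab E] := @MVT_segment R _ _ a b ab (fun s _ => df s).
  apply: continuous_subspaceT => s; apply: differentiable_continuous.
  by apply/derivable1_diffP; case: (df s).
(* Only one factor of D.D is expanded; the other remains the fixed direction of projection. *)
have {1}-> : D = f b - f a - (b - a) *: w by [].
rewrite !dotvBl dotvZl.
have -> : dotv (f b) D - dotv (f a) D - (b - a) * dotv w D =
  dotv (f b) D - b * dotv w D - (dotv (f a) D - a * dotv w D) by ring.
rewrite E mulrAC ler_wpM2r ?subr_ge0//.
rewrite (le_trans (dotv_le_enorm _ _))// ler_wpM2r ?enorm_ge0//.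
by apply: Te; move: cab; rewrite in_itv.
Qed.

Lemma tangent_field_lip f T a b : tangent_field f T ->
  (forall s, enorm (T s) = 1) -> enorm (f b - f a) <= `|b - a|.
Proof.
move=> fT T1; wlog ab : a b / a <= b => [H|].
  have [ab|/ltW ba] := leP a b; first exact: H.
  by rewrite enormB distrC H.
have := @tangent_field_chord f T a b 0 1 fT ab.
rewrite scaler0 subr0 mul1r ger0_norm ?subr_ge0//; apply => s _.
by rewrite subr0 T1.
Qed.

Lemma tangent_field_affine f T x c : c != 0 -> tangent_field f T ->
  tangent_field (fun s => c *: f ((s - x) / c)) (fun s => T ((s - x) / c)).
Proof.
move=> c0 [df cT]; split=> s; last first.
  apply: (@cvg_comp _ _ _ (fun s => (s - x) / c) T); last exact: cT.
  by apply: cvgMl; apply: cvgB => //; exact: cvg_cst.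
apply: is_derive_rV => i.
have di := is_derive_coord i (df ((s - x) / c)).
have da : is_derive s 1 (fun s => (s - x) / c) c^-1.
  have h1 : is_derive s 1 (fun s : R => s - x) (1 - 0) by exact: is_deriveB.
  have := is_derive_mulr c^-1 h1; rewrite subr0 mul1r; exact.
have dc := @is_derive1_comp R (fun x => f x 0 i) _ s _ _ di da.
have := @is_deriveZ R _ _ _ c s 1 _ dc.
rewrite -[c *: (_ * _)]/(c * (_ * _)) mulrCA mulfV// mulr1.
by congr (is_derive _ _ _ _); apply/funext => z /=; rewrite !mxE.
Qed.

Lemma is_derive_glue (V : normedModType R) (f f1 f2 : R -> V) s (d : V) e :
  0 < e ->
  (forall x, s - e <= x <= s -> f x = f1 x) ->
  (forall x, s <= x <= s + e -> f x = f2 x) ->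
  is_derive s 1 f1 d -> is_derive s 1 f2 d -> is_derive s 1 f d.
Proof.
move=> e0 H1 H2 /is_deriveP/cvgrPdist_le d1 /is_deriveP/cvgrPdist_le d2.
apply/is_deriveP/cvgrPdist_le => z z0; near=> h.
have he : `|h| <= e.
  by near: h; exact: dnbhs0_le.
have [h0|h0] := leP h 0.
  rewrite !H1 ?lexx ?gerBl ?(ltW e0)//; last first.
    by move: he; rewrite ler_norml => /andP[]; lra.
  by near: h; exact: d1.
rewrite !H2 ?lexx ?lerDl ?(ltW e0)//; last first.
  by move: he; rewrite ler_norml => /andP[]; lra.
by near: h; exact: d2.
Unshelve. all: by end_near. Qed.

Lemma continuous_at_glue (V : normedModType R) (f f1 f2 : R -> V) s e :
  0 < e ->
  (forall x, s - e <= x <= s -> f x = f1 x) ->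
  (forall x, s <= x <= s + e -> f x = f2 x) ->
  {for s, continuous f1} -> {for s, continuous f2} -> {for s, continuous f}.
Proof.
move=> e0 H1 H2 /cvgrPdist_le d1 /cvgrPdist_le d2.
have /cvgrPdist_le/(_ _ e0) ns : x @[x --> s] --> s by exact: cvg_id.
apply/cvgrPdist_le => z z0; near=> h.
have he : `|s - h| <= e by near: h; exact: ns.
have [h0|h0] := leP h s.
  rewrite !H1 ?lexx ?gerBl ?(ltW e0)//; last first.
    by move: he; rewrite ler_norml => /andP[]; lra.
  by near: h; exact: d1.
rewrite !H2 ?lexx ?lerDl ?(ltW e0)//; last first.
  by move: he; rewrite ler_norml => /andP[]; lra.
by near: h; exact: d2.
Unshelve. all: by end_near. Qed.

End tangent.

(** * Construction of arcs and biarcs from point-tangent data *)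

Section biarcs.
Context {R : realType}.
Implicit Types (f T : R -> 'rV[R]_3) (t u v w p : 'rV[R]_3) (s a b c d e r : R).

Lemma tangent_field_addl f T p :
  tangent_field f T -> tangent_field (fun s => p + f s) T.
Proof.
move=> [df cT]; split=> // s; rewrite -[T s]add0r.
exact: (@is_deriveD _ _ _ (cst p) f).
Qed.

Lemma tangent_field_glue f1 T1 f2 T2 m : f1 m = f2 m -> T1 m = T2 m ->
  tangent_field f1 T1 -> tangent_field f2 T2 ->
  tangent_field (fun s => if s <= m then f1 s else f2 s)
                (fun s => if s <= m then T1 s else T2 s).
Proof.
move=> fm Tm [d1 c1] [d2 c2].
(* Around every s the pieced function is given by one function on the left and one on the right;
   they differ only at s = m, where the values agree and either formula may be used. *)
have glue (h1 h2 : R -> 'rV[R]_3) s : h1 m = h2 m ->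
    exists2 e, 0 < e & exists h h' : R -> 'rV[R]_3,
    [/\ forall x, s - e <= x <= s -> (if x <= m then h1 x else h2 x) = h x,
        forall x, s <= x <= s + e -> (if x <= m then h1 x else h2 x) = h' x &
        h = (if s <= m then h1 else h2) /\ h' = (if m <= s then h2 else h1)].
  move=> hm; case: (ltgtP s m) => [sm|ms|->].
  - exists (m - s); first by rewrite subr_gt0.
    exists h1, h1; split => // x /andP[x1 x2].
      by rewrite ifT//; move: (sm) (x2); lra.
    by rewrite ifT//; lra.
  - exists ((s - m) / 2); first by rewrite divr_gt0// subr_gt0.
    by exists h2, h2; split => // x /andP[x1 x2]; rewrite ifF//; apply/negbTE; rewrite -ltNge; lra.
  - exists 1 => //; exists h1, h2; split => // x /andP[x1 x2].
      by rewrite x2.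
    by case: ifPn => // xm; rewrite (_ : x = m) ?hm//; lra.
split=> s.
- have [e e0 [h [h' [E1 E2 [hE hE']]]]] := glue f1 f2 s fm.
  apply: (is_derive_glue e0 E1 E2); rewrite ?hE ?hE'.
    by case: ifPn.
  case: (ltgtP s m) => // ->.
  by rewrite Tm.
- have [e e0 [h [h' [E1 E2 [hE hE']]]]] := glue T1 T2 s Tm.
  apply: (continuous_at_glue e0 E1 E2); rewrite ?hE ?hE'.
    by case: ifPn => _; [exact: c1|exact: c2].
  by case: ifPn => _; [exact: c2|exact: c1].
Qed.

Lemma tangent_field_circle t v :
  tangent_field (fun s => cos s *: (- v) + sin s *: t)
                (fun s => cos s *: t + sin s *: v).
Proof.
split=> s; last first.
  by apply: cvgD; apply: cvgZl; [exact: continuous_cos|exact: continuous_sin].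
apply: is_derive_rV => i.
have dc := is_derive_mulr ((- v) 0 i) (is_derive_cos s).
have ds := is_derive_mulr (t 0 i) (is_derive_sin s).
have := is_deriveD dc ds.
rewrite (_ : _ + _ = (cos s *: t + sin s *: v) 0 i); last by rewrite !mxE; ring.
by congr (is_derive _ _ _ _); apply/funext => z /=; rewrite !mxE.
Qed.

Lemma dotv_enormB t u : enorm t = 1 -> enorm u = 1 ->
  enorm (u - t) ^+ 2 = 2 - 2 * dotv t u.
Proof.
move=> /dotv_eq1 t1 /dotv_eq1 u1.
by rewrite enorm_sqr dotvBl !dotvBr t1 u1 (dotvC u); ring.
Qed.

(* The arc touches the two segments [p, p + a t] and [p + a t, p + a (t + u)]
   of equal length at their endpoints; its length is proportional to a. *)
Lemma arc_exists t u : enorm t = 1 -> enorm u = 1 -> enorm (u - t) < 2 ->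
  exists2 k, 0 < k & forall p a x, 0 < a -> exists f T,
   [/\ tangent_field f T, forall s, enorm (T s) = 1,
       circular_arc f x (x + a * k),
       [/\ f x = p, T x = t, f (x + a * k) = p + a *: (t + u) &
           T (x + a * k) = u] &
       forall s, x <= s <= x + a * k -> enorm (T s - t) <= enorm (u - t)].
Proof.
move=> t1 u1 ut2; have E := dotv_enormB t1 u1.
(* The straight case, where the radius would be infinite; the two segments together have length 2a,
   hence k = 2. *)
have [->|/eqP ut] := eqVneq u t.
  exists 2 => // p a x a0; exists (fun s => p + (s - x) *: t), (cst t); split => //.
  - apply: tangent_field_addl; split=> s; last exact: cvg_cst.
    apply: is_derive_rV => i.
    have h1 : is_derive s 1 (fun s : R => s - x) (1 - 0) by exact: is_deriveB.
    have := is_derive_mulr (t 0 i) h1; rewrite subr0 mul1r.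
    by congr (is_derive _ _ _ _); apply/funext => z /=; rewrite !mxE.
  - by left; exists p, t.
  - split=> //; first by rewrite subrr scale0r addr0.
    by rewrite addrAC subrr add0r scalerDr -scalerDl; congr (_ + _ *: _); ring.
set C := dotv t u in E *.
have C1 : C < 1.
  have : 0 < enorm (u - t) ^+ 2 by rewrite exprn_gt0// enorm_gt0// => /subr0_eq.
  by rewrite E; lra.
have CN1 : -1 < C.
  have : enorm (u - t) ^+ 2 < 2 ^+ 2 by rewrite ltr_pXn2r// nnegrE ?enorm_ge0.
  by rewrite E; lra.
(* [th] is the turning angle; |u - t| < 2 excludes [th = pi], that is opposite tangents. *)
set th := acos C; set S := sin th.
have Ci : -1 <= C <= 1 by rewrite !ltW.
have cth : cos th = C by rewrite /th acosK// in_itv.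
have th0 : 0 < th by rewrite /th acos_gt0// C1 ltW.
have thpi : th < pi by rewrite /th acos_ltpi// CN1 ltW.
have S0 : 0 < S by rewrite sin_gt0_pi// th0.
have S2 : S ^+ 2 = 1 - C ^+ 2 by rewrite /S sin2cos2 cth.
have k0 : 0 < S / (1 - C) by rewrite divr_gt0// subr_gt0.
exists (S / (1 - C) * th); first by rewrite mulr_gt0.
(* S / (1 - C) is cot(th / 2): a circle touching two segments of length a with turning angle th has
   radius a cot(th / 2), and the arc has length r th. *)
move=> p a x a0; set r := a * (S / (1 - C)); rewrite mulrA -/r.
have r0 : 0 < r by rewrite mulr_gt0.
have tt := dotv_eq1 t1; have uu := dotv_eq1 u1.
(* Gram-Schmidt: [v] is the unit normal to [t], in the plane of [t] and [u], towards which the arc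
   bends. *)
have [v [tv vv uE]] : exists v, [/\ dotv t v = 0, dotv v v = 1 & u = C *: t + S *: v].
  exists (S^-1 *: (u - C *: t)); split.
  - by rewrite dotvZr dotvBr dotvZr tt -/C; ring.
  - rewrite dotvZl dotvZr dotvBl !dotvBr !dotvZl !dotvZr uu tt (dotvC u t) -/C.
    rewrite (_ : 1 - _ - _ = S ^+ 2); last by rewrite S2; ring.
    by field; rewrite gt_eqF.
  - by rewrite scalerA mulfV ?gt_eqF// scale1r addrC subrK.
have rS : r * S = a * (1 + C).
  rewrite /r -mulrA mulrAC -expr2 S2; field; lra.
have rC : r * (1 - C) = a * S by rewrite /r; field; lra.
have TE s : enorm (cos s *: t + sin s *: v) = 1.
  apply: enorm_eq1; rewrite dotvDl !dotvDr !dotvZl !dotvZr tt vv (dotvC v) tv.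
  by rewrite -[RHS](cos2Dsin2 s); ring.
set f0 := fun s => cos s *: (- v) + sin s *: t.
exists (fun s => p + r *: v + r *: f0 ((s - x) / r)),
  (fun s => cos ((s - x) / r) *: t + sin ((s - x) / r) *: v).
have xr : (x + r * th - x) / r = th by field; rewrite gt_eqF.
split => //.
- apply: tangent_field_addl; have rn : r != 0 by rewrite gt_eqF.
  exact: (tangent_field_affine x rn (tangent_field_circle t v)).
- right; exists (p + r *: v), (- v), t, r; split => //.
  + by rewrite addrAC subrr add0r mulrC ler_pM2r//; lra.
  + split=> //; [by rewrite enormN; apply: enorm_eq1|by rewrite dotvNl dotvC tv oppr0].
  + by move=> s _; rewrite /f0 scalerDr !scalerA addrA.
- rewrite subrr mul0r xr cos0 sin0 /f0 cos0 sin0 !scale0r !addr0 !scale1r cth -/S.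
  split => //; first by rewrite scalerN addrK.
    apply/rowP => i; rewrite uE !mxE.
    transitivity (p 0 i + r * (1 - C) * v 0 i + r * S * t 0 i); first by ring.
    by rewrite rS rC; ring.
(* |T s - t|^2 is 2 minus twice the cosine of the angle turned so far, and the cosine decreases on
   [0, pi]. *)
- move=> s /andP[s1 s2].
  have p0 : 0 <= (s - x) / r by rewrite divr_ge0// ?subr_ge0// ltW.
  have p1 : (s - x) / r <= th by rewrite ler_pdivrMr// lerBlDr addrC mulrC.
  rewrite -(@ler_pXn2r _ 2) ?nnegrE ?enorm_ge0// E dotv_enormB//.
  rewrite dotvDr !dotvZr tt tv mulr0 addr0 mulr1 -cth lerD2l lerN2 ler_pM2l//.
  by rewrite leNgt ltr_cos -?leNgt// in_itv/=; lra.
Qed.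

(* [a] is the positive root of |v - a (t0 + t1)| = 2 a: the control polygon
   p0, p0 + a t0, p1 - a t1, p1 then carries two arcs that meet at the midpoint
   of its middle edge. *)
Lemma biarc_control (v t0 t1 : 'rV[R]_3) d e :
  enorm t0 = 1 -> enorm t1 = 1 -> 0 < d -> 0 < e -> e <= 1 / 100 ->
  enorm (v - d *: t0) <= e * d -> enorm (t1 - t0) <= e ->
  exists a u, [/\ 0 < a, enorm u = 1, enorm (u - t0) <= 7 * e &
                  v = a *: (t0 + u) + a *: (u + t1)].
Proof.
move=> n0 n1 d0 e0 e1 vd tt.
have s0 := dotv_eq1 n0; have s1 := dotv_eq1 n1.
set b := dotv v t0 + dotv v t1; set V := dotv v v; set c := 1 - dotv t0 t1.
have ed0 : 0 < e * d by rewrite mulr_gt0.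
have ed1 : e * d <= d / 100 by rewrite mulrC ler_pM2l//; lra.
have nv : enorm v <= d + e * d.
  rewrite -{1}(subrK (d *: t0) v) (le_trans (ler_enormD _ _))//.
  by rewrite enormZ n0 mulr1 gtr0_norm// addrC lerD2l.
have vt0 : d - e * d <= dotv v t0.
  have := le_trans (norm_dotv_le (v - d *: t0) t0) _; rewrite n0 mulr1.
  by move=> /(_ _ vd); rewrite dotvBl dotvZl s0 mulr1 ler_norml => /andP[]; lra.
have vt1 : d - e * d - 2 * (e * d) <= dotv v t1.
  have : `|dotv v (t1 - t0)| <= (d + e * d) * e.
    by rewrite (le_trans (norm_dotv_le _ _))// ler_pM ?enorm_ge0.
  have : (d + e * d) * e <= 2 * (e * d) by nra.
  by rewrite dotvBr ler_norml => h1 /andP[]; lra.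
have b0 : 19 / 10 * d <= b by rewrite /b; lra.
have V0 : 0 < V.
  rewrite lt_neqAle dotv_ge0 andbT eq_sym; apply/eqP => V0.
  have : enorm v = 0 by rewrite /enorm -/V V0 sqrtr0.
  by move/enorm_eq0 => v0; move: vt0; rewrite v0 /dotv big1 => [|i _]; [lra|rewrite mxE mul0r].
have V1 : V <= 103 / 100 * d ^+ 2.
  rewrite /V -enorm_sqr (@le_trans _ _ ((101 / 100 * d) ^+ 2))//.
    by rewrite ler_pXn2r ?nnegrE ?enorm_ge0//; lra.
  by rewrite exprMn ler_pM2r ?exprn_gt0//; lra.
have c0 : 0 <= c.
  have := dotv_enormB n0 n1; have := sqr_ge0 (enorm (t1 - t0)).
  by rewrite /c; move=> h1 h2; move: h1; rewrite h2; lra.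
(* The condition on [a] reads V = 2 a b + 2 c a^2. Its positive root is taken in the form V / (b +
   D), which stays meaningful for [c = 0], that is for [t0 = t1]. *)
set D := Num.sqrt (b ^+ 2 + 2 * c * V).
have D0 : 0 <= D by exact: sqrtr_ge0.
have D2 : D ^+ 2 = b ^+ 2 + 2 * c * V.
  by rewrite sqr_sqrtr// addr_ge0 ?sqr_ge0// !mulr_ge0// ltW.
have bD : 0 < b + D by lra.
have [a a0 aV] : exists2 a, 0 < a & a * (b + D) = V.
  by exists (V / (b + D)); rewrite ?divr_gt0// divfK// gt_eqF.
have aE : V = 2 * a * b + 2 * c * a ^+ 2.
  have h : D - b = 2 * c * a.
    apply: (mulIf (x := b + D)); first by rewrite gt_eqF.
    transitivity (D ^+ 2 - b ^+ 2); first by ring.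
    transitivity (2 * c * V); first by rewrite D2; ring.
    by rewrite -aV; ring.
  rewrite -[LHS]aV; transitivity (2 * a * b + a * (D - b)); first by ring.
  by rewrite h; ring.
have a1 : a <= 3 / 10 * d.
  have : a * (2 * b) <= 103 / 100 * d ^+ 2.
    by apply: le_trans V1; rewrite aE; have := mulr_ge0 c0 (sqr_ge0 a); lra.
  have : a * (38 / 10 * d) <= a * (2 * b) by rewrite ler_pM2l//; lra.
  move=> h1 h2; have h3 := le_trans h1 h2; rewrite -(ler_pM2r d0); lra.
(* The middle edge of the control polygon: its length is 2a by the choice of a, and its direction is
   the tangent [u] at the matching point. *)
have [w wE] : exists w, w = v - a *: (t0 + t1) by eexists.
have ww : dotv w w = (2 * a) ^+ 2.
  rewrite wE dotvBl !dotvBr !dotvZl !dotvZr !dotvDl !dotvDr s0 s1 (dotvC t1 t0) (dotvC t0 v) (dotvC t1 v).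
  rewrite -/V; have -> : dotv t0 t1 = 1 - c by rewrite /c; ring.
  have -> : dotv v t0 = b - dotv v t1 by rewrite /b; ring.
  by rewrite aE; ring.
have nw : enorm w = 2 * a.
  by rewrite /enorm ww sqrtr_sqr ger0_norm// mulr_ge0// ltW.
exists a, ((2 * a)^-1 *: w); split => //.
- by rewrite enormZ nw gtr0_norm ?invr_gt0 ?mulr_gt0// mulVf// gt_eqF// mulr_gt0.
- have ea1 : a * e <= a / 100 by rewrite ler_pM2l//; lra.
  have ea0 : 0 < a * e by rewrite mulr_gt0.
  have w1 : enorm (w - (v - (2 * a) *: t0)) <= a * e.
    have -> : w - (v - (2 * a) *: t0) = a *: (t0 - t1).
      by rewrite wE; apply/rowP => i; rewrite !mxE; ring.
    by rewrite enormZ gtr0_norm// ler_pM2l// enormB.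
  have w2 : enorm ((v - (2 * a) *: t0) - (d - 2 * a) *: t0) <= e * d.
    by rewrite [X in enorm X](_ : _ = v - d *: t0)//; apply/rowP => i; rewrite !mxE; ring.
  have w3 : enorm (w - (d - 2 * a) *: t0) <= a * e + e * d.
    by apply: le_trans (ler_enormB _ _ _) (lerD w1 w2).
  (* Nearby vectors have nearby norms: 2a and d - 2a almost agree, so a is about d / 4. This yields
     the bound d <= 5a below. *)
  have w4 : `|2 * a - (d - 2 * a)| <= a * e + e * d.
    apply: le_trans w3; apply: le_trans (ler_dist_enorm _ _).
    by rewrite nw enormZ n0 mulr1 (ger0_norm (x := d - 2 * a))//; lra.
  have w5 : enorm (w - (2 * a) *: t0) <= 2 * (a * e + e * d).
    rewrite -(subrKA ((d - 2 * a) *: t0)) (le_trans (ler_enormD _ _))//.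
    have := w4; rewrite -scalerBl enormZ n0 mulr1 (distrC (d - 2 * a)); lra.
  have -> : (2 * a)^-1 *: w - t0 = (2 * a)^-1 *: (w - (2 * a) *: t0).
    by rewrite scalerBr scalerA mulVf ?scale1r// gt_eqF// mulr_gt0.
  rewrite enormZ gtr0_norm ?invr_gt0 ?mulr_gt0// mulrC ler_pdivrMr ?mulr_gt0//.
  apply: (le_trans w5); move: w4; rewrite ler_norml => /andP[h1 h2].
  have d5 : d <= 5 * a by lra.
  have : e * d <= e * (5 * a) by rewrite ler_pM2l.
  lra.
- rewrite -scalerDr; have -> : t0 + (2 * a)^-1 *: w + ((2 * a)^-1 *: w + t1) =
      (t0 + t1) + (2 * (2 * a)^-1) *: w.
    by apply/rowP => i; rewrite !mxE; ring.
  rewrite scalerDr scalerA (_ : a * _ = 1); last by field; rewrite gt_eqF.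
  by rewrite scale1r wE addrC subrK.
Qed.

(** The length [l] is fixed before [c] and [x] because the common factor [c] is computed from the
    lengths of all biarcs, and each biarc starts where the previous one ends. The constant 15 is 7 +
    8, the deviations of the tangent along the two arcs. *)
Lemma biarc_exists (p0 t0 p1 t1 : 'rV[R]_3) d e :
  enorm t0 = 1 -> enorm t1 = 1 -> 0 < d -> 0 < e -> e <= 1 / 100 ->
  enorm (p1 - p0 - d *: t0) <= e * d -> enorm (t1 - t0) <= e ->
  exists l, [/\ 0 < l, `|l - d| <= 20 * e * d & forall c x, 0 < c -> exists f T,
   [/\ tangent_field f T, forall s, enorm (T s) = 1, biarc f x (x + c * l),
       [/\ f x = c *: p0, T x = t0, f (x + c * l) = c *: p1 &
           T (x + c * l) = t1] &
       forall s, x <= s <= x + c * l -> enorm (T s - t0) <= 15 * e]].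
Proof.
move=> n0 n1 d0 e0 e1 vd tt.
have [a [u [a0 nu ut vE]]] := biarc_control n0 n1 d0 e0 e1 vd tt.
have tu : enorm (t1 - u) <= 8 * e.
  by rewrite (le_trans (ler_enormB _ _ t0))//; move: ut; rewrite enormB; lra.
have [|k k0 A] := arc_exists n0 nu; first by lra.
have [|k' k0' A'] := arc_exists nu n1; first by lra.
have p01 : p0 <> p1.
  move=> p01; move: vd; rewrite p01 subrr sub0r enormN enormZ n0 mulr1 gtr0_norm//.
  by rewrite -[leLHS]mul1r ler_pM2r//; lra.
have M c x : 0 < c -> exists f T,
   [/\ tangent_field f T, forall s, enorm (T s) = 1, biarc f x (x + c * (a * (k + k'))),
       [/\ f x = c *: p0, T x = t0, f (x + c * (a * (k + k'))) = c *: p1 &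
           T (x + c * (a * (k + k'))) = t1] &
       forall s, x <= s <= x + c * (a * (k + k')) -> enorm (T s - t0) <= 15 * e].
  move=> c0; have ca0 : 0 < c * a by rewrite mulr_gt0.
  have [f [T [fT T1 fa [fx Tx fy Ty] Tt]]] := A (c *: p0) (c * a) x ca0.
  set m := x + c * a * k in fa fy Ty Tt.
  have [f' [T' [fT' T1' fa' [fx' Tx' fy' Ty'] Tt']]] := A' (f m) (c * a) m ca0.
  set y := m + c * a * k' in fa' fy' Ty' Tt'.
  have -> : x + c * (a * (k + k')) = y by rewrite /y /m; ring.
  have xm : x < m by rewrite /m ltrDl mulr_gt0.
  have my : m < y by rewrite /y ltrDl mulr_gt0.
  have fyE : f' y = c *: p1.
    rewrite fy' fy -addrA -!scalerA -(scalerDr c) -vE -scalerDr; congr (_ *: _).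
    by rewrite addrC subrK.
  exists (fun s => if s <= m then f s else f' s), (fun s => if s <= m then T s else T' s).
  have xme : (x <= m) = true by exact: ltW.
  have yme : (y <= m) = false by apply/negbTE; rewrite -ltNge.
  split.
  - by apply: tangent_field_glue => //; rewrite Tx'.
  - by move=> s; case: ifP.
  - split; first by rewrite xme yme fx fyE => /(scalerI (lt0r_neq0 c0)).
    exists m; split; first by rewrite xm.
      case: fa => [[p [v [nv E]]]|[q [v [w [r [r0 br vw E]]]]]].
        left; exists p, v; split=> // s sI; rewrite ifT ?E//.
        by case/andP: sI.
      right; exists q, v, w, r; split=> // s sI; rewrite ifT ?E//.
      by case/andP: sI.
    have E0 s : m <= s <= y -> (if s <= m then f s else f' s) = f' s.
      move=> /andP[ms _]; case: ifPn => // sm.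
      by rewrite (_ : s = m) ?fx'//; apply/le_anti; rewrite sm ms.
    case: fa' => [[p [v [nv E]]]|[q [v [w [r [r0 br vw E]]]]]].
      by left; exists p, v; split=> // s sI; rewrite E0 ?E.
    by right; exists q, v, w, r; split=> // s sI; rewrite E0 ?E.
  - by rewrite xme yme fx Tx fyE Ty'.
  - move=> s /andP[xs sy]; case: ifPn => [sm|].
      by rewrite (le_trans (Tt s _)) ?xs//; lra.
    rewrite -ltNge => ms; rewrite (le_trans (ler_enormB _ _ u))//.
    have := Tt' s; rewrite (ltW ms) sy => /(_ isT); lra.
set l := a * (k + k') in M; have l0 : 0 < l by rewrite /l mulr_gt0// addr_gt0.
exists l; split => //.
(* The length is estimated on the unscaled biarc: its chord is within 15 e l of l t0 and, by
   hypothesis, within e d of d t0. *)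
have [f [T [fT T1 _ [fx Tx fy Ty] Tt]]] := M 1 0 ltr01.
rewrite add0r mul1r !scale1r in fx fy Tt.
have := tangent_field_chord fT (ltW l0) Tt; rewrite fx fy subr0 => h1.
have h : enorm ((l - d) *: t0) <= 15 * e * l + e * d.
  have -> : (l - d) *: t0 = (p1 - p0 - d *: t0) - (p1 - p0 - l *: t0).
    by apply/rowP => i; rewrite !mxE; ring.
  by rewrite (le_trans (ler_enormD _ _))// enormN addrC lerD.
move: h; rewrite enormZ n0 mulr1 => h; apply: (le_trans h).
have ed0 : 0 < e * d by rewrite mulr_gt0.
have h2 : 15 * e * l <= 15 / 100 * l by rewrite ler_pM2r//; lra.
have h3 : e * d <= d / 100 by rewrite mulrC ler_pM2l//; lra.
have h4 : l <= 119 / 100 * d by move: h; rewrite ler_norml => /andP[]; lra.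
have : e * l <= e * (119 / 100 * d) by rewrite ler_pM2l.
lra.
Qed.

End biarcs.

(** * Uniform continuity, separation and stability of injectivity for closed curves *)

Section closed_curves.
Context {R : realType} {L : {posnum R}}.
Implicit Types (g h : C1ia L) (s t x y e d : R).

Lemma periodicZ (V : Type) (f : R -> V) : (forall s, f (s + L%:num) = f s) ->
  forall (k : int) s, f (s + k%:~R * L%:num) = f s.
Proof.
move=> pf.
have pfn (n : nat) t : f (t + L%:num *+ n) = f t.
  by elim: n => [|n IH]; rewrite ?addr0// mulrSr addrA pf IH.
case=> n s; first by rewrite mulr_natl pfn.
rewrite NegzE mulrNz mulNr -[RHS](congr1 f (subrK (L%:num *+ n.+1) s)) pfn.
by rewrite mulr_natl.
Qed.

Lemma period_shift s : exists k : int, 0 <= s - k%:~R * L%:num < L%:num.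
Proof.
exists (Num.floor (s / L%:num)); rewrite subr_ge0 -ler_pdivlMr// floor_le/=.
by rewrite ltrBlDr -[X in X + _]mul1r -mulrDl -ltr_pdivrMr// addrC -[1]/(1%:~R) -intrD floorD1_gt.
Qed.

Lemma derive1_C1iaD g s : derive1 g (s + L%:num) = derive1 g s.
Proof. exact/derive1_periodic/curve_periodic. Qed.

Lemma periodic_unif_continuous (G : R -> 'rV[R]_3) e : continuous G ->
  (forall s, G (s + L%:num) = G s) -> 0 < e -> exists2 d, 0 < d &
  forall s t, `|s - t| <= d -> enorm (G s - G t) <= e.
Proof.
move=> cG pG e0.
(* Heine-Cantor on one period: [x] is confined to [0, L] but [t] is not, so shifting both arguments
   by the same multiple of L reduces the general case to this one. The modulus is |d| because d runs
   through a neighbourhood of 0. *)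
have : \forall d \near 0, forall x, `[0, L%:num]%classic x ->
    forall t, `|x - t| <= `|d : R| -> enorm (G x - G t) <= e.
  have /compact_near_coveringP nc := @segment_compact R 0 L%:num.
  apply: (nc R (nbhs (0 : R)) (fun d x => forall t, `|x - t| <= `|d : R| ->
    enorm (G x - G t) <= e) _) => x _.
  have cg : enorm (G y - G x) @[y --> x] -->
      enorm (G x - G x).
    have h : G y - G x @[y --> x] --> G x - G x.
      by apply: cvgB; [exact: cG|exact: cvg_cst].
    exact: cvg_enorm h.
  have [r r0 H] : exists2 r, 0 < r &
      forall y, `|x - y| < r -> enorm (G y - G x) <= e / 2.
    have e20 : 0 < e / 2 by rewrite divr_gt0.
    have E : enorm (G x - G x) = 0 by rewrite (subrr (G x)) enorm0.
    rewrite E in cg; move/cvgrPdist_le : cg => /(_ _ e20)[r r0 H].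
    exists r => // y xy.
    by apply: le_trans (H y xy); rewrite (distrC 0) (subr0 (enorm _)) ler_norm.
  have r20 : 0 < r / 2 by rewrite divr_gt0.
  exists (ball x (r / 2), ball 0 (r / 2)); first by split; exact: nbhsx_ballx.
  move=> [y z] /= [xy z0] t yt.
  rewrite /ball/= in xy; rewrite /ball/= sub0r normrN in z0.
  rewrite (le_trans (ler_enormB _ _ (G x)))// (splitr e) lerD//.
    by apply: H; apply: lt_le_trans xy _; lra.
  rewrite enormB; apply: H.
  rewrite -(subrKA y) (le_lt_trans (ler_normD _ _))//.
  by have := le_lt_trans yt z0; lra.
move=> [d d0 H]; exists (d / 2); first by rewrite divr_gt0.
move=> s t st; have [k /andP[k0 k1]] := period_shift s.
have p := periodicZ pG (- k).
rewrite -(p s) -(p t) !mulrNz !mulNr; apply: (H (d / 2)).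
- rewrite /ball/= sub0r normrN gtr0_norm ?divr_gt0//.
  by move: d0 => /=; lra.
- by rewrite /= in_itv/= k0 ltW.
- rewrite (gtr0_norm (x := d / 2)) ?divr_gt0//; apply: le_trans st.
  by rewrite le_eqVlt; apply/orP; left; apply/eqP; congr `|_|; ring.
Qed.

Lemma derive1_C1ia_unif g e : 0 < e -> exists2 d, 0 < d &
  forall s t, `|s - t| <= d -> enorm (derive1 g s - derive1 g t) <= e.
Proof.
move=> e0; apply: periodic_unif_continuous e0.
  exact: curve_continuous_derive.
exact: derive1_C1iaD.
Qed.

Lemma C1ia_separation g d : 0 < d -> exists2 m, 0 < m &
  forall s t, (forall k : int, d <= `|s - t - k%:~R * L%:num|) ->
    m <= enorm (g s - g t).
Proof.
(* If L - d < d, no two points of the circle are at distance d or more, and any [m] will do. *)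
move=> d0; have [dL|dL] := leP d (L%:num - d); last first.
  exists 1 => // s t H; exfalso.
  have [k /andP[k0 k1]] := period_shift (s - t).
  have := H k; have := H (k + 1); rewrite (ger0_norm k0) intrD mulrDl mul1r.
  by rewrite ler0_norm; lra.
pose A : set (R * R) := `[0, L%:num] `*` `[d, L%:num - d].
pose f (z : R * R) := enorm (g (z.1 + z.2) - g z.1).
have cf : continuous f.
  move=> z.
  have h : g (z'.1 + z'.2) - g z'.1 @[z' --> z] --> g (z.1 + z.2) - g z.1; last first.
    exact: cvg_enorm h.
  apply: cvgB.
    apply: (@cvg_comp _ _ _ (fun z : R * R => z.1 + z.2) g); last exact: C1ia_continuous.
    by apply: cvgD; [exact: cvg_fst|exact: cvg_snd].
  by apply: (@cvg_comp _ _ _ fst g); [exact: cvg_fst|exact: C1ia_continuous].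
have A0 : A !=set0.
  by exists (0, d); split => /=; rewrite in_itv/= lexx// ltW.
have cA : compact A by apply: compact_setX; exact: segment_compact.
have [[a b] /set_mem[/= aI bI] H] := compact_EVT_min A0 cA (continuous_subspaceT cf).
exists (f (a, b)).
  rewrite /f/=; apply: enorm_gt0 => /subr0_eq /curve_injective[k].
  rewrite addrAC subrr add0r => bk; move: bI; rewrite in_itv/= bk => /andP[b1 b2].
  have k0 : (0 < k)%R by rewrite -(@ltr0z R) -(@pmulr_lgt0 _ L%:num)// (lt_le_trans d0).
  have : (1 : R) <= k%:~R by rewrite ler1z.
  by move/(ler_wpM2r (ltW [gt0 of L%:num])); lra.
move=> s t st; have [k /andP[k0 k1]] := period_shift t.
have [l /andP[l0 l1]] := period_shift (s - t).
have p := periodicZ (curve_periodic g).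
have mA : A (t - k%:~R * L%:num, s - t - l%:~R * L%:num).
  split => /=; first by rewrite in_itv/= k0 ltW.
  rewrite in_itv/=; apply/andP; split; first by have := st l; rewrite ger0_norm.
  by have := st (l + 1); rewrite intrD mulrDl mul1r ler0_norm; lra.
have := H _ (mem_set mA); rewrite {2}/f/=.
rewrite (_ : t - k%:~R * L%:num + (s - t - l%:~R * L%:num) = s + (- k - l)%:~R * L%:num).
  by rewrite p (_ : t - _ = t + (- k)%:~R * L%:num) ?p// mulrNz mulNr.
by rewrite intrB mulrNz; ring.
Qed.

(** Over parameter distances up to d the tangent of f changes by at most 1/2, so f cannot return to
    the same point; beyond d the chords of g are at least m, hence those of f at least m / 2. *)
Lemma injective_C1_stable g : exists2 e, 0 < e &
  forall f T, tangent_field f T -> (forall s, enorm (T s) = 1) ->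
    (forall s, f (s + L%:num) = f s) ->
    (forall s, enorm (f s - g s) <= e) ->
    (forall s, enorm (T s - derive1 g s) <= e) ->
  forall s t, f s = f t -> exists k : int, s - t = k%:~R * L%:num.
Proof.
have [|d d0 Hd] := @derive1_C1ia_unif g (1 / 4); first by lra.
move: (derive1 g) Hd => G Hd.
have [m m0 Hm] := C1ia_separation g d0.
exists (Num.min (1 / 8) (m / 4)); first by rewrite lt_min; apply/andP; split; lra.
move=> f T fT T1 pf fg Tg s t fst.
have {}fg x : enorm (f x - g x) <= m / 4 by rewrite (le_trans (fg x))// ge_min lexx orbT.
have {}Tg x : enorm (T x - G x) <= 1 / 8 by rewrite (le_trans (Tg x))// ge_min lexx.
(* 1/4 from the tangent of g and twice 1/8 from comparing the tangents give 1/2; a closed-up chord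
   would force b - a <= (b - a) / 2. *)
have loc a b : a <= b -> b - a <= d -> f b = f a -> b = a.
  move=> ab bad fba.
  have := @tangent_field_chord _ f T a b (T a) (1 / 2) fT ab.
  have H x : a <= x <= b -> enorm (T x - T a) <= 1 / 2.
    move=> /andP[ax xb]; rewrite (le_trans (ler_enormB _ _ (G x)))//.
    have h1 := Tg x; have h2 := Tg a.
    have h3 : enorm (G x - G a) <= 1 / 4.
      by apply: Hd; rewrite ger0_norm ?subr_ge0// (le_trans _ bad)// lerD2r.
    have := ler_enormB (G x) (T a) (G a).
    by rewrite (enormB (G a)); lra.
  move=> /(_ H); rewrite fba subrr sub0r enormN enormZ T1 mulr1 ger0_norm; lra.
have [H|/existsNP[k /negP]] := pselect (forall k : int, d <= `|s - t - k%:~R * L%:num|).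
  exfalso; have := Hm _ _ H; have h1 := fg s; have h2 := fg t.
  have := ler_enormB (g s) (g t) (f s); rewrite (enormB (g s) (f s)) [in f s - g t]fst; lra.
rewrite -ltNge => sk; exists k.
have ft' : f s = f (t + k%:~R * L%:num) by rewrite (periodicZ pf).
rewrite -addrA -opprD in sk.
have [st|st] := leP s (t + k%:~R * L%:num).
  have := loc _ _ st _ (esym ft'); rewrite ler0_norm in sk; last by rewrite subr_le0.
  by rewrite opprB in sk; move=> /(_ (ltW sk)) <-; rewrite addrAC subrr add0r.
have := loc _ _ (ltW st) _ ft'; rewrite gtr0_norm in sk; last by rewrite subr_gt0.
by move=> /(_ (ltW sk)) ->; rewrite addrAC subrr add0r.
Qed.

Lemma C1dist_ge g h s :
  enorm (g s - h s) <= C1dist g h /\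
  enorm (derive1 g s - derive1 h s) <= C1dist g h.
Proof.
rewrite C1distE.
have [_ s1] := has_sup_subC1ia g h; have [_ s2] := has_sup_derive1_subC1ia g h.
have h1 t : enorm (g t - h t) <= sup (range (fun s => enorm (g s - h s))).
  by apply: ub_le_sup => //; exists t.
have h2 t : enorm (derive1 g t - derive1 h t) <=
    sup (range (fun s => enorm (derive1 g s - derive1 h s))).
  by apply: ub_le_sup => //; exists t.
have := h1 s; have := h2 s; have := enorm_ge0 (g s - h s).
have := enorm_ge0 (derive1 g s - derive1 h s); lra.
Qed.

Lemma C1dist_le g h e : (forall s, enorm (g s - h s) <= e) ->
  (forall s, enorm (derive1 g s - derive1 h s) <= e) -> C1dist g h <= e + e.
Proof.
move=> h1 h2; rewrite C1distE lerD//; apply: ge_sup.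
- by exists (enorm (g 0 - h 0)), 0.
- by move=> _ [s _ <-].
- by exists (enorm (derive1 g 0 - derive1 h 0)), 0.
- by move=> _ [s _ <-].
Qed.

End closed_curves.

(** * Partitions of the circle and concatenation of curves along them *)

Section cyclic_partition.
Context {R : realType} {L : {posnum R}}.
Implicit Types (s : nat -> R) (n i j : nat) (x y : R) (k l : int).

Definition cyclic_partition n s :=
  s n = s 0%N + L%:num /\ forall i, (i < n)%N -> s i < s i.+1.

Lemma partition_mono n s i j : (forall i, (i < n)%N -> s i < s i.+1) ->
  (i <= j <= n)%N -> s i <= s j.
Proof.
move=> sI; elim: j => [|j IH] /andP[ij jn]; first by move: ij; rewrite leqn0 => /eqP ->.
move: ij; rewrite leq_eqVlt => /orP[/eqP->//|]; rewrite ltnS => ij.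
by rewrite (le_trans (IH _))// ?ij ?(ltnW jn)// ltW// sI.
Qed.

Lemma partition_cover n s x : (forall i, (i < n)%N -> s i < s i.+1) ->
  s 0%N <= x < s n -> exists2 i, (i < n)%N & s i <= x < s i.+1.
Proof.
elim: n => [|n IH] sI /andP[x0 xn]; first by move: xn; rewrite ltNge x0.
have [xn'|xn'] := ltP x (s n); last by exists n; rewrite ?xn'.
have [||i ni H] := IH; first by move=> i ni; apply: sI; exact: ltnW.
  by rewrite x0.
by exists i => //; exact: ltnW.
Qed.

Lemma partition_uniq n s i j x : (forall i, (i < n)%N -> s i < s i.+1) ->
  (i < n)%N -> (j < n)%N -> s i <= x < s i.+1 -> s j <= x < s j.+1 -> i = j.
Proof.
move=> sI ni nj /andP[i1 i2] /andP[j1 j2].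
have H a b : (b < n)%N -> s a.+1 <= s b -> x < s a.+1 -> s b <= x -> False.
  by move=> _ h1 h2 h3; move: (lt_le_trans h2 h1); rewrite ltNge h3.
case: (ltngtP i j) => // ij; exfalso.
  by apply: (H i j) => //; apply: (partition_mono sI); rewrite ij ltnW.
by apply: (H j i) => //; apply: (partition_mono sI); rewrite ij ltnW.
Qed.

Lemma cyclic_partition_gt0 n s : cyclic_partition n s -> (0 < n)%N.
Proof.
case: n => // -[+ _] => /eqP; rewrite -subr_eq0 opprD addrA subrr sub0r oppr_eq0.
by rewrite gt_eqF.
Qed.

Lemma cyclic_partition_cover n s x : cyclic_partition n s ->
  exists i k, (i < n)%N /\ s i <= x - k%:~R * L%:num < s i.+1.
Proof.
move=> [sn sI]; have [k /andP[k0 k1]] := @period_shift R L (x - s 0%N).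
have [|i ni H] := @partition_cover n s (x - k%:~R * L%:num) sI.
  by rewrite sn; apply/andP; split; lra.
by exists i, k.
Qed.

Lemma cyclic_partition_uniq n s x i j k l : cyclic_partition n s ->
  (i < n)%N -> (j < n)%N ->
  s i <= x - k%:~R * L%:num < s i.+1 -> s j <= x - l%:~R * L%:num < s j.+1 ->
  i = j /\ k = l.
Proof.
move=> [sn sI] ni nj H1 H2.
(* All cells lie in the one period from s 0 to s 0 + L, so x determines its shift, and the claim for
   cells becomes the non-cyclic one. *)
have kl : k = l.
  have M a (m : int) : (a < n)%N -> s a <= x - m%:~R * L%:num < s a.+1 ->
      s 0%N <= x - m%:~R * L%:num < s 0%N + L%:num.
    move=> an /andP[m1 m2]; apply/andP; split.
      by apply: le_trans m1; apply: (partition_mono sI); rewrite leq0n ltnW.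
    by apply: lt_le_trans m2 _; rewrite -sn; apply: (partition_mono sI); rewrite an leqnn.
  have := M _ _ ni H1; have := M _ _ nj H2 => /andP[h1 h2] /andP[h3 h4].
  have P a b : (a%:~R - b%:~R) * L%:num < L%:num -> (a <= b)%R.
    rewrite -[X in _ < X]mul1r ltr_pM2r// -intrB -[1]/(1%:~R) ltr_int.
    by move=> ?; lia.
  by apply/le_anti/andP; split; apply: P; rewrite mulrBl; lra.
by split=> //; move: H2; rewrite -kl => H2; apply: (partition_uniq sI ni nj H1 H2).
Qed.

(** Half-open cells give each x exactly one cell and shift. A right end point is then evaluated in
    the next cell, which the common values [p] make harmless. *)
Lemma periodic_concat (V : Type) n s (f : nat -> R -> V) (p : nat -> V) :
  cyclic_partition n s ->
  (forall i, (i < n)%N -> f i (s i) = p i /\ f i (s i.+1) = p i.+1) ->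
  p n = p 0%N ->
  exists F : R -> V, (forall x, F (x + L%:num) = F x) /\
    forall i x, (i < n)%N -> s i <= x <= s i.+1 -> F x = f i x.
Proof.
move=> ps fp pn.
have /choice[N HN] : forall x, exists z : nat * int, (z.1 < n)%N /\
    s z.1 <= x - z.2%:~R * L%:num < s z.1.+1.
  by move=> x; have [i [k ik]] := cyclic_partition_cover x ps; exists (i, k).
pose F x := f (N x).1 (x - (N x).2%:~R * L%:num).
have FE x i k : (i < n)%N -> s i <= x - k%:~R * L%:num < s i.+1 ->
    F x = f i (x - k%:~R * L%:num).
  move=> ni H; have [h1 h2] := HN x.
  by rewrite /F; have [-> ->] := cyclic_partition_uniq ps h1 ni h2 H.
exists F; split=> [x|i x ni /andP[x1 x2]].
  have [ni H] := HN x; have E : x + L%:num - ((N x).2 + 1)%:~R * L%:num =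
      x - (N x).2%:~R * L%:num by rewrite intrD; ring.
  by rewrite (FE _ _ ((N x).2 + 1) ni) E.
have x0 : x - 0%:~R * L%:num = x by rewrite mul0r subr0.
move: x2; rewrite le_eqVlt => /orP[/eqP xs|x2]; last first.
  by rewrite (FE _ i 0 ni) x0// x1.
have [_ ->] : f i (s i) = p i /\ f i x = p i.+1 by rewrite xs; exact: fp.
(* The right end of the last cell is the left end of cell 0, one period on. *)
move: (ni); rewrite leq_eqVlt => /orP[/eqP ni'|ni'].
  have x1' : x - 1%:~R * L%:num = s 0%N by rewrite xs ni' ps.1; ring.
  have n0 := cyclic_partition_gt0 ps.
  rewrite (FE _ 0%N 1 n0) x1'; first by rewrite (fp _ n0).1 ni' pn.
  by rewrite lexx ps.2.
rewrite (FE _ i.+1 0 ni') x0 xs; first by rewrite (fp _ ni').1.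
by rewrite lexx ps.2.
Qed.

Lemma tangent_field_shift (f T : R -> 'rV[R]_3) x : tangent_field f T ->
  tangent_field (fun z => f (z - x)) (fun z => T (z - x)).
Proof.
move=> /(@tangent_field_affine R f T x 1 (oner_neq0 _)).
have E (h : R -> 'rV[R]_3) : (fun z => h ((z - x) / 1)) = fun z => h (z - x).
  by apply/funext => s; rewrite divr1.
rewrite (E T); congr (tangent_field _ _).
by apply/funext => s; rewrite scale1r divr1.
Qed.

(** Differentiability and continuity are verified from both sides of each x: [right] and [left] find
    a cell that contains, up to a period, a one-sided neighbourhood of x. *)
Lemma tangent_field_concat n s (f T : nat -> R -> 'rV[R]_3) p t :
  cyclic_partition n s ->
  (forall i, (i < n)%N -> [/\ tangent_field (f i) (T i),
     f i (s i) = p i, f i (s i.+1) = p i.+1, T i (s i) = t i &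
     T i (s i.+1) = t i.+1]) ->
  p n = p 0%N -> t n = t 0%N ->
  exists F U, [/\ tangent_field F U, forall x, F (x + L%:num) = F x,
    forall x, U (x + L%:num) = U x &
    forall i x, (i < n)%N -> s i <= x <= s i.+1 -> F x = f i x /\ U x = T i x].
Proof.
move=> ps H pn tn.
have [|F [pF EF]] := periodic_concat (f := f) ps _ pn; first by move=> i /H[].
have [|U [pU EU]] := periodic_concat (f := T) ps _ tn; first by move=> i /H[].
exists F, U; split=> //; last by move=> i x ni xI; rewrite (EF i)// (EU i).
have right x : exists e i k, [/\ 0 < e, (i < n)%N,
    s i <= x - k%:~R * L%:num &
    forall y, x <= y <= x + e -> s i <= y - k%:~R * L%:num <= s i.+1].
  have [i [k [ni /andP[h1 h2]]]] := cyclic_partition_cover x ps.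
  exists (s i.+1 - (x - k%:~R * L%:num)), i, k; split=> //; first by rewrite subr_gt0.
  by move=> y /andP[y1 y2]; apply/andP; split; lra.
(* At a junction the left neighbourhood lies in the previous cell; for s 0 this is the last cell of
   the preceding period. *)
have left x : exists e i k, [/\ 0 < e, (i < n)%N &
    forall y, x - e <= y <= x -> s i <= y - k%:~R * L%:num <= s i.+1].
  have [i [k [ni /andP[]]]] := cyclic_partition_cover x ps.
  rewrite le_eqVlt => /orP[/eqP h1 h2|h1 h2].
    case: i ni h1 h2 => [|i] ni h1 h2.
      exists (s n - s n.-1), n.-1, (k - 1).
      have n0 := cyclic_partition_gt0 ps.
      have sn := ps.1; have := ps.2 n.-1; rewrite prednK// leqnn => /(_ isT) ss.
      split=> //; first by rewrite subr_gt0.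
      by move=> y /andP[y1 y2]; rewrite intrB mulrBl mul1r; apply/andP; split; lra.
    exists (s i.+1 - s i), i, k; have ss := ps.2 _ (ltnW ni).
    split=> //; [by rewrite subr_gt0|exact: ltnW|].
    by move=> y /andP[y1 y2]; apply/andP; split; lra.
  exists (x - k%:~R * L%:num - s i), i, k; split=> //; first by rewrite subr_gt0.
  by move=> y /andP[y1 y2]; apply/andP; split; lra.
have pE (V : Type) (h : R -> V) k y : (forall x, h (x + L%:num) = h x) ->
    h y = h (y - k%:~R * L%:num).
  by move=> /periodicZ/(_ (- k) y); rewrite mulrNz mulNr => ->.
have key x : exists e h1 T1 h2 T2, [/\ 0 < e, tangent_field h1 T1, tangent_field h2 T2,
    forall y, x - e <= y <= x -> F y = h1 y /\ U y = T1 y &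
    forall y, x <= y <= x + e -> F y = h2 y /\ U y = T2 y].
  have [e1 [i [k [e10 ni _ H1]]]] := right x.
  have [e2 [j [l [e20 nj H2]]]] := left x.
  exists (Num.min e1 e2), (fun y => f j (y - l%:~R * L%:num)),
    (fun y => T j (y - l%:~R * L%:num)), (fun y => f i (y - k%:~R * L%:num)),
    (fun y => T i (y - k%:~R * L%:num)).
  have [h1 h2] : Num.min e1 e2 <= e1 /\ Num.min e1 e2 <= e2.
    by rewrite !ge_min !lexx orbT.
  split=> //.
  - by rewrite lt_min e10.
  - by apply: tangent_field_shift; case: (H j nj).
  - by apply: tangent_field_shift; case: (H i ni).
  - move=> y /andP[y1 y2]; have yI := H2 y; rewrite (pE _ F l)// (pE _ U l)//.
    by rewrite (EF j) ?(EU j)//; apply: yI; rewrite y2 andbT; lra.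
  - move=> y /andP[y1 y2]; have yI := H1 y; rewrite (pE _ F k)// (pE _ U k)//.
    by rewrite (EF i) ?(EU i)//; apply: yI; rewrite y1 /=; lra.
split=> x; have [e [h1 [T1 [h2 [T2 [e0 t1 t2 E1 E2]]]]]] := key x.
  have [e1 e2] : U x = T1 x /\ U x = T2 x.
    by split; [apply: (proj2 (E1 x _))|apply: (proj2 (E2 x _))];
      rewrite lexx ?andbT ?gerBl ?lerDl ltW.
  apply: (is_derive_glue e0 (fun y yI => proj1 (E1 y yI)) (fun y yI => proj1 (E2 y yI))).
    by rewrite e1; exact: t1.1.
  by rewrite e2; exact: t2.1.
apply: (continuous_at_glue e0 (fun y yI => proj2 (E1 y yI)) (fun y yI => proj2 (E2 y yI))).
  exact: t1.2.
exact: t2.2.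
Qed.

Lemma biarc_ext (f g : R -> 'rV[R]_3) a b :
  (forall x, a <= x <= b -> g x = f x) -> biarc f a b -> biarc g a b.
Proof.
move=> E [fab [m [/andP[am mb] A1 A2]]].
have arc c d : a <= c -> d <= b -> circular_arc f c d -> circular_arc g c d.
  move=> ac db H.
  have E' x : c <= x <= d -> g x = f x.
    by move=> /andP[cx xd]; apply: E; rewrite (le_trans ac cx) (le_trans xd db).
  case: H => [[p [u [u1 H]]]|[p [u [v [r [r0 dc uv H]]]]]].
    by left; exists p, u; split=> // x xI; rewrite E'// H.
  by right; exists p, u, v, r; split=> // x xI; rewrite E'// H.
have ab := ltW (lt_trans am mb).
split; first by rewrite !E ?lexx ?ab.
by exists m; split; [rewrite am|apply: arc => //; exact: ltW..].
Qed.

End cyclic_partition.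

Arguments cyclic_partition {R} L n s.

(** * Interpolation by biarcs, rescaled to length L *)

Section interpolation.
Context {R : realType} {L : {posnum R}}.
Implicit Types (g : C1ia L) (s : nat -> R) (n i j : nat).

Lemma mesh_small (a b : R) : 0 < a -> 0 < b -> exists N, forall n, (N <= n)%N ->
  (0 < n)%N /\ a / n%:R <= b.
Proof.
move=> a0 b0; exists (Num.bound (a / b)).+1 => n Nn.
have n0 : (0 < n)%N by exact: leq_trans Nn.
split=> //; rewrite ler_pdivrMr ?ltr0n// mulrC -ler_pdivrMr//.
have := archi_boundP (ltW (divr_gt0 a0 b0)) => /ltW/le_trans; apply.
by rewrite ler_nat ltnW.
Qed.

Lemma small4 (a b c d : R) : 0 < a -> 0 < b -> 0 < c -> 0 < d ->
  exists e, [/\ 0 < e, e <= a, e <= b, e <= c & e <= d].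
Proof.
move=> a0 b0 c0 d0; exists (Num.min (Num.min a b) (Num.min c d)).
by split; rewrite ?lt_min ?ge_min ?lexx ?a0 ?b0 ?c0 ?d0 ?orbT.
Qed.

Lemma sum_perturb s (l : nat -> R) n (e : R) : 0 <= e ->
  (forall i, (i < n)%N -> `|l i - (s i.+1 - s i)| <= e * (s i.+1 - s i)) ->
  forall i, (i <= n)%N ->
    `|\sum_(k < i) l k - (s i - s 0%N)| <= e * (s i - s 0%N).
Proof.
move=> e0 H; elim=> [_|i IH ni]; first by rewrite big_ord0 !subrr normr0 mulr0.
rewrite big_ord_recr/=.
have -> : \sum_(k < i) l k + l i - (s i.+1 - s 0%N) =
  (\sum_(k < i) l k - (s i - s 0%N)) + (l i - (s i.+1 - s i)) by ring.
have -> : e * (s i.+1 - s 0%N) = e * (s i - s 0%N) + e * (s i.+1 - s i) by ring.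
rewrite (le_trans (ler_normD _ _))// lerD//; first by apply: IH; exact: ltnW.
exact: H.
Qed.

(** The exponent q + 2 counts factors: [1 <= c * rho] bounds A / c by rho A, which enters to the
    power q, and each of the two lengths contributes one more rho. *)
Lemma tp_term_le (q rho c A l1 l2 d1 d2 : R) : 0 <= q -> 0 < c -> 0 <= A -> 1 <= rho ->
  1 <= c * rho -> 0 <= l1 -> 0 <= l2 -> c * l1 <= rho * d1 -> c * l2 <= rho * d2 ->
  0 <= d1 -> 0 <= d2 ->
  (A / c) `^ q * (c * l1) * (c * l2) <= rho `^ (q + 2) * (A `^ q * d1 * d2).
Proof.
move=> q0 c0 A0 r1 cr l10 l20 h1 h2 d10 d20.
have r0 : 0 < rho by exact: lt_le_trans r1.
have -> : rho `^ (q + 2) * (A `^ q * d1 * d2) = (rho * A) `^ q * (rho * d1) * (rho * d2).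
  rewrite powRM ?(ltW r0)// powRD; last by rewrite (gt_eqF r0) implybT.
  by rewrite (_ : rho `^ 2 = rho ^+ 2) ?powR_mulrn ?(ltW r0)//; ring.
have c1 : 0 <= c by exact: ltW.
apply: ler_pM => //; [|by rewrite mulr_ge0|]; first by rewrite mulr_ge0 ?powR_ge0 ?mulr_ge0.
apply: ler_pM => //; rewrite ?powR_ge0 ?mulr_ge0//.
apply: ge0_ler_powR => //; rewrite ?nnegrE ?divr_ge0 ?mulr_ge0 ?(ltW r0)//.
by rewrite ler_pdivrMr// mulrAC ler_peMl// mulrC.
Qed.

(** [c] brings the total length back to L. A junction drifts by at most 20 eta L through accumulated
    length errors and by as much again through the factor [c]. *)
Lemma rescaled_lengths s (l : nat -> R) n (eta : R) : 0 < eta -> eta <= 1 / 1000 ->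
  s n = s 0%N + L%:num -> (forall i, (i < n)%N -> 0 < s i.+1 - s i) ->
  (forall i, (i < n)%N -> 0 < l i) ->
  (forall i, (i < n)%N -> `|l i - (s i.+1 - s i)| <= 20 * eta * (s i.+1 - s i)) ->
  exists c, [/\ 0 < c, c * \sum_(k < n) l k = L%:num, `|c - 1| <= 21 * eta,
    c * (1 - 20 * eta) <= 1 /\ 1 <= c * (1 + 20 * eta) &
    forall i, (i <= n)%N ->
      `|s 0%N + c * \sum_(k < i) l k - s i| <= 40 * eta * L%:num].
Proof.
move=> eta0 eta1 sn dl l0 Hl; have L0 : 0 < L%:num :> R by [].
pose S i := \sum_(k < i) l k.
have SP i : (i <= n)%N -> `|S i - (s i - s 0%N)| <= 20 * eta * (s i - s 0%N).
  by apply: (sum_perturb _ Hl); rewrite mulr_ge0// ltW.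
have s0n i : (i <= n)%N -> s 0%N <= s i <= s 0%N + L%:num.
  move=> ni; rewrite -sn; have H : forall i, (i < n)%N -> s i < s i.+1.
    by move=> k kn; rewrite -subr_gt0 dl.
  by apply/andP; split; apply: (partition_mono H); rewrite ?leq0n ?ni ?leqnn.
have SM i : (i <= n)%N -> 0 <= S i <= S n.
  move=> ni; have HS k m : (k <= m <= n)%N -> S k <= S m.
    elim: m => [|m IH] /andP[km mn]; first by move: km; rewrite leqn0 => /eqP ->.
    move: km; rewrite leq_eqVlt => /orP[/eqP->//|]; rewrite ltnS => km.
    rewrite (le_trans (IH _)) ?km ?(ltnW mn)//.
    by rewrite /S big_ord_recr/= lerDl ltW// l0.
  apply/andP; split; last by apply: HS; rewrite ni leqnn.
  by rewrite (_ : 0 = S 0%N) ?HS ?leq0n//; rewrite /S big_ord0.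
have LL : `|S n - L%:num| <= 20 * eta * L%:num.
  by have := SP n (leqnn n); rewrite sn [s 0%N + _]addrC addrK.
rewrite -/(S n); move: (S n) SM LL => L' SM LL.
have EL : eta * L%:num <= L%:num / 1000 by rewrite mulrC ler_pM2l//; lra.
have EL0 : 0 < eta * L%:num by rewrite mulr_gt0.
have [LL1 LL2] : L' - L%:num <= 20 * eta * L%:num /\ L%:num - L' <= 20 * eta * L%:num.
  by move: LL; rewrite ler_norml => /andP[]; lra.
have L'0 : 0 < L' by lra.
have [c c0 cL] : exists2 c, 0 < c & c * L' = L%:num.
  by exists (L%:num / L'); rewrite ?divr_gt0// divfK// gt_eqF.
have cL' : `|c - 1| * L' <= 20 * eta * L%:num.
  by rewrite -[L' in leLHS]gtr0_norm// -normrM mulrBl cL mul1r distrC.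
exists c; split=> //.
- rewrite -(ler_pM2r L'0) (le_trans cL')//.
  have : eta * (98 / 100 * L%:num) <= eta * L' by rewrite ler_pM2l//; lra.
  lra.
- split; rewrite -(ler_pM2r L0) mul1r.
    by rewrite -[leRHS]cL -mulrA ler_pM2l//; lra.
  by rewrite -[leLHS]cL -mulrA ler_pM2l//; lra.
- move=> i ni; rewrite -/(S i).
  have -> : s 0%N + c * S i - s i = (c - 1) * S i + (S i - (s i - s 0%N)) by ring.
  have h1 : `|(c - 1) * S i| <= 20 * eta * L%:num.
    have /andP[h1 h2] := SM _ ni; rewrite normrM (ger0_norm h1).
    by apply: le_trans cL'; rewrite ler_wpM2l.
  have h2 : `|S i - (s i - s 0%N)| <= 20 * eta * L%:num.
    apply: (le_trans (SP _ ni)); rewrite -!mulrA ler_pM2l// ler_pM2l//.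
    by have := s0n _ ni; lra.
  by rewrite (le_trans (ler_normD _ _))//; lra.
Qed.

Lemma biarc_interpolation g (q eps : R) : 0 <= q -> 0 < eps -> exists N, forall n s,
  (N <= n)%N -> s n = s 0%N + L%:num ->
  (forall i, (i < n)%N ->
    3 / 4 * (L%:num / n%:R) <= s i.+1 - s i <= 5 / 4 * (L%:num / n%:R)) ->
  exists (h : C1ia L) r, [/\ in_B n h r, C1dist h g <= eps &
    discrete_sum q n h r <= (1 + eps) * discrete_sum q n g s].
Proof.
move=> q0 eps0; have L0 : 0 < L%:num :> R by [].
have [ei ei0 Hinj] := injective_C1_stable g.
have gG := tangent_field_C1ia g; have G1 := curve_arclength g.
have unif := @derive1_C1ia_unif R L g.
have pG := derive1_C1iaD g; have pg := curve_periodic g.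
have [M [M0 gM]] : exists M, 0 <= M /\ forall x, enorm (g x) <= M.
  have [_ hs] := @has_sup_periodic R L (fun x => enorm (g x))
    (fun x => congr1 _ (pg x)) (continuous_enorm (@C1ia_continuous _ _ g)).
  have H x : enorm (g x) <= sup (range (fun x => enorm (g x))).
    by apply: ub_le_sup => //; exists x.
  by exists (sup (range (fun x => enorm (g x)))); split=> //; exact: le_trans (enorm_ge0 _) (H 0).
have [e [e0 eeps eei]] : exists e, [/\ 0 < e, e <= eps / 2 & e <= ei].
  by have [|e [? ? ? _ _]] := @small4 (eps / 2) ei 1 1 _ ei0 ltr01 ltr01; [rewrite divr_gt0|exists e].
(* Chosen so that rho^(q + 2), the growth allowed to each term of the energy, is 1 + eps. *)
pose rho := (1 + eps) `^ (q + 2)^-1.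
have q20 : 0 < q + 2 by apply: ltr_wpDl.
have rho1 : 1 < rho.
  have -> : 1 = 1 `^ (q + 2)^-1 :> R by rewrite powR1.
  apply: gt0_ltr_powR; rewrite ?nnegrE ?invr_gt0//.
    by rewrite addr_ge0// ltW.
  by rewrite ltrDl.
have rhoE : rho `^ (q + 2) = 1 + eps.
  by rewrite /rho -powRrM mulVf ?gt_eqF// powRr1// addr_ge0// ltW.
clearbody rho.
have e20 : 0 < e / 2 by rewrite divr_gt0.
have [d' d'0 Hd'] := unif _ e20.
(* Errors per unit of eta: 15 from the tangents of the biarcs, 21 M (rounded up to 25 M) from
   scaling the points by c, 40 L from the junction drift. *)
pose B := 15 + 25 * M + 40 * L%:num.
have B0 : 0 < B by rewrite /B; lra.
have [eta [eta0 eta1 eta2 eta3 eta4]] :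
    exists eta, [/\ 0 < eta, eta <= 1 / 1000, eta * (20 * (1 + rho)) <= rho - 1,
                    eta * (80 * L%:num) <= d' & eta * (2 * B) <= e].
  have a2 : 0 < 20 * (1 + rho) by lra.
  have a3 : 0 < 80 * L%:num by rewrite mulr_gt0.
  have a4 : 0 < 2 * B by rewrite mulr_gt0.
  have a20 : 0 < (rho - 1) / (20 * (1 + rho)) by rewrite divr_gt0// subr_gt0.
  have [|eta [h h1 h2 h3 h4]] := @small4 (1 / 1000) _ _ _ _ a20 (divr_gt0 d'0 a3) (divr_gt0 e0 a4).
    by lra.
  by exists eta; rewrite -!ler_pdivlMr.
have [d d0 Hd] := unif _ eta0.
(* The bound on the mesh L / n: d / 2 keeps every gap below d, d' / 4 leaves half of d' for the
   junction drift, and e / 8 allows four mesh widths in the distance between the curves. *)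
have [b [b0 b1 b2 b3 _]] : exists b, [/\ 0 < b, b <= d / 2, b <= d' / 4, b <= e / 8 & b <= 1].
  by apply: small4 => //; rewrite divr_gt0.
have [N HN] := mesh_small L0 b0.
exists N => n s Nn sn sI.
have {HN Nn}[n0 nb] := HN _ Nn; set hn := L%:num / n%:R in sI nb.
have hn0 : 0 < hn by rewrite divr_gt0// ltr0n.
have dl i : (i < n)%N -> 0 < s i.+1 - s i by move=> /sI/andP[]; clear -hn0; lra.
have du i : (i < n)%N -> s i.+1 - s i <= d.
  by move=> /sI/andP[_]; clear -nb b1 hn0; lra.
have GD := @tangent_field_derive1 R.
have [G GE] : exists G, derive1 g = G by eexists.
rewrite GE in gG G1 pG Hinj Hd Hd'.
pose p i := g (s i); pose t i := G (s i).
have pn : p n = p 0%N by rewrite /p sn pg.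
have tn : t n = t 0%N by rewrite /t sn pG.
have /choice[l Hl] : forall i, exists l, (i < n)%N -> [/\ 0 < l,
    `|l - (s i.+1 - s i)| <= 20 * eta * (s i.+1 - s i) &
    forall c x, 0 < c -> exists f T,
   [/\ tangent_field f T, forall y, enorm (T y) = 1, biarc f x (x + c * l),
       [/\ f x = c *: p i, T x = t i, f (x + c * l) = c *: p i.+1 &
           T (x + c * l) = t i.+1] &
       forall y, x <= y <= x + c * l -> enorm (T y - t i) <= 15 * eta]].
  move=> i; have [ni|ni] := boolP (i < n)%N; last by exists 0.
  have [|||l Hl] := @biarc_exists R (p i) (t i) (p i.+1) (t i.+1) (s i.+1 - s i) eta
     (G1 _) (G1 _) (dl _ ni) eta0.
  - by clear -eta1; lra.
  - apply: tangent_field_chord gG _ _; first by rewrite -subr_ge0 ltW ?dl.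
    move=> x /andP[x1 x2]; apply: Hd.
    by rewrite ger0_norm ?subr_ge0//; have := du i ni; clear -x1 x2; lra.
  - apply: Hd; rewrite gtr0_norm ?dl//; exact: du.
  - by exists l.
pose S i := \sum_(k < i) l k.
have [c [c0 cL cd [c1 c2] sgs]] := rescaled_lengths eta0 eta1 sn dl
  (fun i ni => let: And3 h _ _ := Hl i ni in h) (fun i ni => let: And3 _ h _ := Hl i ni in h).
have rhoc : 1 + 20 * eta <= rho * (1 - 20 * eta) by clear -eta2; lra.
have [cd1 cd2] : c <= 103 / 100 /\ 97 / 100 <= c.
  by move: cd; rewrite ler_norml; clear -eta1; move=> /andP[]; lra.
pose sg i := s 0%N + c * S i.
have sgS i : sg i.+1 = sg i + c * l i by rewrite /sg /S big_ord_recr/=; ring.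
have {}sgs i : (i <= n)%N -> `|sg i - s i| <= 40 * eta * L%:num := sgs i.
have sgn : sg n = sg 0%N + L%:num.
  by rewrite /sg {2}/S big_ord0 mulr0 addr0 cL.
have cl0 i : (i < n)%N -> 0 < c * l i by move=> /Hl[l0 _ _]; rewrite mulr_gt0.
have psg : cyclic_partition L n sg by split=> // i ni; rewrite sgS ltrDl cl0.
have lb i : (i < n)%N -> (1 - 20 * eta) * (s i.+1 - s i) <= l i /\
    l i <= (1 + 20 * eta) * (s i.+1 - s i).
  by move=> /Hl[_ + _]; rewrite ler_norml; clear; move=> /andP[]; lra.
have clr i : (i < n)%N -> c * l i <= rho * (s i.+1 - s i).
  move=> ni; have [_ h] := lb i ni; apply: (@le_trans _ _ (c * ((1 + 20 * eta) * (s i.+1 - s i)))).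
    by rewrite ler_pM2l.
  rewrite mulrA ler_pM2r ?dl// (@le_trans _ _ (c * (rho * (1 - 20 * eta))))//.
    by rewrite ler_pM2l.
  by rewrite mulrCA ler_piMr//; clear -rho1; lra.
(* The gaps lie between 3/4 and 5/4 of the mesh and the corrections by [l] and [c] are a few per
   cent, so the factors 1/2 and 2 are respected. *)
have clh i : (i < n)%N -> hn / 2 <= c * l i <= 2 * hn.
  move=> ni; have [h1 h2] := lb i ni; have /andP[h3 h4] := sI i ni.
  have h5 : 98 / 100 * (s i.+1 - s i) <= l i.
    apply: le_trans h1; rewrite ler_pM2r ?dl//; clear -eta1; lra.
  have h6 : l i <= 102 / 100 * (s i.+1 - s i).
    apply: (le_trans h2); rewrite ler_pM2r ?dl//; clear -eta1; lra.
  have l0 : 0 <= l i by case: (Hl i ni) => /ltW.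
  have h7 : 97 / 100 * l i <= c * l i by rewrite ler_wpM2r.
  have h8 : c * l i <= 103 / 100 * l i by rewrite ler_wpM2r.
  by apply/andP; clear -h3 h4 h5 h6 h7 h8 hn0; split; lra.
have /choice[fT HfT] : forall i, exists fT : (R -> 'rV[R]_3) * (R -> 'rV[R]_3),
    (i < n)%N -> [/\ tangent_field fT.1 fT.2, forall y, enorm (fT.2 y) = 1,
       biarc fT.1 (sg i) (sg i.+1),
       [/\ fT.1 (sg i) = c *: p i, fT.2 (sg i) = t i, fT.1 (sg i.+1) = c *: p i.+1 &
           fT.2 (sg i.+1) = t i.+1] &
       forall y, sg i <= y <= sg i.+1 -> enorm (fT.2 y - t i) <= 15 * eta].
  move=> i; have [ni|ni] := boolP (i < n)%N; last by exists (cst 0, cst 0).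
  have [_ _ H] := Hl i ni; have [f [T fTH]] := H c (sg i) c0.
  by exists (f, T); rewrite sgS.
have [|||F [U [FU pF pU E]]] := @tangent_field_concat R L n sg (fun i => (fT i).1)
  (fun i => (fT i).2) (fun i => c *: p i) t psg.
- by move=> i /HfT[? _ _ [? ? ? ?] _]; split.
- by rewrite pn.
- exact: tn.
have rep x : exists i k, [/\ (i < n)%N, sg i <= x - k%:~R * L%:num <= sg i.+1 &
    forall V (f : R -> V), (forall y, f (y + L%:num) = f y) -> f x = f (x - k%:~R * L%:num)].
  have [i [k [ni /andP[h1 /ltW h2]]]] := cyclic_partition_cover x psg.
  exists i, k; split=> //; first by rewrite h1.
  by move=> V f /periodicZ/(_ (- k) x); rewrite mulrNz mulNr => ->.
have U1 x : enorm (U x) = 1.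
  have [i [k [ni xI ->//]]] := rep x; have [_ ->] := E i _ ni xI.
  by have [_ ->] := HfT i ni.
have near i y : (i < n)%N -> sg i <= y <= sg i.+1 -> `|s i - y| <= 2 * hn + 40 * eta * L%:num.
  move=> ni /andP[y1 y2]; have := sgs i (ltnW ni); have /andP[_] := clh i ni.
  rewrite sgS in y2; rewrite !ler_norml => h1 /andP[h2 h3]; apply/andP.
  by clear -y1 y2 h1 h2 h3 hn0; split; lra.
have UG x : enorm (U x - G x) <= e.
  have [i [k [ni xI H]]] := rep x; rewrite (H _ U pU) (H _ G pG).
  move: (x - _) xI => y yI {H}; have [_ ->] := E i _ ni yI.
  have [_ _ _ _ /(_ _ yI) h1] := HfT i ni.
  have h2 : enorm (t i - G y) <= e / 2 by apply: Hd'; apply: le_trans (near i y ni yI) _; clear -eta3 nb b2; lra.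
  have h3 : 15 * eta <= e / 2.
    have h4 := mulr_ge0 (ltW eta0) M0; have h5 := mulr_gt0 eta0 L0.
    by rewrite /B in eta4; clear -eta4 h4 h5; lra.
  by rewrite (le_trans (ler_enormB _ _ (t i)))//; clear -h1 h2 h3; lra.
have Fg x : enorm (F x - g x) <= e.
  have [i [k [ni xI H]]] := rep x; rewrite (H _ F pF) (H _ g pg).
  move: (x - _) xI => y yI {H}; have [-> _] := E i _ ni yI.
  have [fTi Ti1 _ [fi _ _ _] _] := HfT i ni.
  have h1 : enorm ((fT i).1 y - c *: p i) <= 2 * hn.
    rewrite -fi (le_trans (tangent_field_lip _ _ fTi Ti1))//.
    case/andP: yI => y1 y2; have /andP[_] := clh i ni; rewrite sgS in y2.
    rewrite ger0_norm ?subr_ge0//; clear -y1 y2; lra.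
  have h2 : enorm (c *: p i - p i) <= 21 * eta * M.
    rewrite -[X in _ - X]scale1r -scalerBl enormZ.
    by apply: ler_pM => //; [exact: enorm_ge0|exact: gM].
  have h3 : enorm (p i - g y) <= 2 * hn + 40 * eta * L%:num.
    by apply: (le_trans (tangent_field_lip _ _ gG G1)); exact: near.
  have h4 : 25 * eta * M + 40 * eta * L%:num <= e / 2.
    by rewrite /B in eta4; clear -eta4 eta0; lra.
  have h5 := mulr_ge0 (ltW eta0) M0.
  have := ler_enormB ((fT i).1 y) (g y) (c *: p i).
  have := ler_enormB (c *: p i) (g y) (p i).
  by clear -h1 h2 h3 h4 h5 nb b3 e0; lra.
have dF := GD _ _ FU.
have Finj := Hinj F U FU U1 pF (fun x => le_trans (Fg x) eei) (fun x => le_trans (UG x) eei).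
have Fd x : derivable F x 1 by case: (FU.1 x).
have Fc : continuous (derive1 F) by rewrite dF; exact: FU.2.
have F1 x : enorm (derive1 F x) = 1 by rewrite dF.
pose h := @MkC1ia R L F pF Fd Fc F1 Finj.
have hE i : (i < n)%N -> h (sg i) = c *: p i /\ derive1 h (sg i) = t i.
  move=> ni; rewrite /= dF; have [|-> ->] := E i (sg i) ni.
    by rewrite lexx sgS lerDl ltW ?cl0.
  by have [_ _ _ [-> -> _ _] _] := HfT i ni.
exists h, sg; split.
- split; first split=> // i ni.
    by apply: (@biarc_ext R (fT i).1) => [x xI|]; [exact: (E i x ni xI).1|case: (HfT i ni)].
  move=> i ni; rewrite /biarc_length sgS [sg i + _]addrC addrK.
  by have := clh i ni; rewrite /hn mulrA [_ / n%:R / 2]mulrAC -(mulrA L%:num) -invfM.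
- apply: le_trans (C1dist_le (e := e) _ _) _; last by clear -eeps; lra.
    by move=> x; exact: Fg.
  by move=> x; rewrite GE /= dF; exact: UG.
- rewrite /discrete_sum mulr_sumr; apply: ler_sum => i _.
  rewrite mulr_sumr; apply: ler_sum => j _.
  have [-> _] := hE i (ltn_ord i); have [-> ->] := hE j (ltn_ord j).
  rewrite (tp_quotientZ _ _ c0 (G1 (s j))) /biarc_length !sgS.
  rewrite ![sg _ + _]addrC !addrK -rhoE GE.
  apply: tp_term_le => //.
  + exact: tp_quotient_ge0.
  + exact: ltW.
  + apply: (le_trans c2); rewrite ler_pM2l//.
    by apply: (le_trans rhoc); rewrite ler_piMr//; clear -eta0 rho1; lra.
  + by case: (Hl i (ltn_ord i)) => /ltW.
  + by case: (Hl j (ltn_ord j)) => /ltW.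
  + exact: clr.
  + exact: clr.
  + by rewrite ltW// dl.
  + by rewrite ltW// dl.
Qed.

End interpolation.

(** * Step functions on the square of the circle *)

Section step_functions.
Context {R : realType} {L : {posnum R}}.
Implicit Types (s : nat -> R) (n i j : nat) (x y : R) (k : int) (w : nat -> nat -> R).

Notation mu := (@lebesgue_measure R).

(** The trace on the fundamental domain [0, L) of an interval of a partition that may start
    anywhere. It can wrap around 0, so it need not be an interval. *)
Definition cell s i : set R :=
  [set x | 0 <= x < L%:num /\ exists k : int, s i <= x - k%:~R * L%:num < s i.+1].

Lemma cell_uniq n s i j x : cyclic_partition L n s -> (i < n)%N -> (j < n)%N ->
  cell s i x -> cell s j x -> i = j.
Proof.
move=> ps ni nj [_ [k H]] [_ [l H']].
by have [] := cyclic_partition_uniq ps ni nj H H'.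
Qed.

Lemma cell_cover n s x : cyclic_partition L n s -> 0 <= x < L%:num ->
  exists2 i, (i < n)%N & cell s i x.
Proof.
move=> ps xL; have [i [k [ni H]]] := cyclic_partition_cover x ps.
by exists i => //; split=> //; exists k.
Qed.

Lemma cell_near n s i x e : (i < n)%N ->
  (forall i, (i < n)%N -> s i.+1 - s i <= e) -> cell s i x ->
  exists k, `|x - (s i + k%:~R * L%:num)| <= e.
Proof.
move=> ni se [_ [k /andP[k1 k2]]]; exists k; have := se i ni.
by rewrite ger0_norm; lra.
Qed.

Lemma cell_measure n s i : cyclic_partition L n s -> (i < n)%N ->
  measurable (cell s i) /\ mu (cell s i) = (s i.+1 - s i)%:E.
Proof.
move=> ps ni; have L0 : 0 < L%:num :> R by [].
have [k0 /andP[k1 k2]] := @period_shift R L (s 0%N).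
pose a := s i - k0%:~R * L%:num; pose b := s i.+1 - k0%:~R * L%:num.
have ab : a < b by rewrite /a /b ltrD2r ps.2.
have a0 : 0 <= a.
  apply: (le_trans k1); rewrite /a lerD2r.
  by apply: (partition_mono ps.2); rewrite leq0n ltnW.
have h1 : s i.+1 <= s n by apply: (partition_mono ps.2); rewrite leqnn ni.
have h0 : s 0%N <= s i by apply: (partition_mono ps.2); rewrite leq0n ltnW.
have bL : b < 2 * L%:num by rewrite ps.1 in h1; rewrite /b; lra.
have baL : b <= a + L%:num by rewrite ps.1 in h1; rewrite /b /a; lra.
have -> : s i.+1 - s i = b - a by rewrite /a /b; ring.
(* With s 0 moved into [0, L), the interval [a, b) lies in [0, 2L), so only it and its translate by
   -L can meet the fundamental domain. *)
have cE : cell s i = [set x | 0 <= x < L%:num /\ (a <= x < b \/ a <= x + L%:num < b)].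
  apply/seteqP; split => x [xL H]; split => //.
    move: H => [k /andP[h2 h3]].
    have H m : m%:~R * L%:num < 1 * L%:num -> (m <= 0)%R.
      by rewrite ltr_pM2r// -[1]/(1%:~R) ltr_int; lia.
    have H' m : (-2) * L%:num < m%:~R * L%:num -> (-1 <= m)%R.
      by rewrite ltr_pM2r// (_ : -2 = (-2)%:~R)// ltr_int; lia.
    have {}h2 : a <= x - (k + k0)%:~R * L%:num by rewrite intrD; move: h2; rewrite /a; lra.
    have {}h3 : x - (k + k0)%:~R * L%:num < b by rewrite intrD; move: h3; rewrite /b; lra.
    have m0 : (k + k0 <= 0)%R by apply: H; case/andP: xL; lra.
    have m1 : (-1 <= k + k0)%R by apply: H'; case/andP: xL; lra.
    have [E0|E1] : (k + k0 = 0)%R \/ (k + k0 = -1)%R by lia.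
      by left; rewrite E0 mul0r subr0 in h2 h3; rewrite h2.
    right; rewrite E1 mulN1r opprK in h2 h3; by rewrite h2.
  move: H => [|] /andP[h2 h3].
    by exists (- k0); rewrite mulrNz; move: h2 h3; rewrite /a /b => h2 h3; apply/andP; split; lra.
  exists (- k0 - 1); rewrite intrB mulrNz; move: h2 h3; rewrite /a /b => h2 h3.
  by apply/andP; split; lra.
have itv c d : c < d -> mu `[c, d[%classic = (d - c)%:E.
  by move=> cd; rewrite lebesgue_measure_itv/= lte_fin cd -EFinB.
have [bl|bl] := leP b L%:num.
  have -> : cell s i = `[a, b[%classic.
    rewrite cE; apply/seteqP; split=> x /=; rewrite in_itv/=.
      by move=> [/andP[? ?] [|] /andP[? ?]]; apply/andP; split; lra.
    by move=> /andP[? ?]; split; [apply/andP; split; lra|left; apply/andP].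
  by split; [exact: measurable_itv|exact: itv].
have [al|al] := leP L%:num a.
  have -> : cell s i = `[a - L%:num, b - L%:num[%classic.
    rewrite cE; apply/seteqP; split=> x /=; rewrite in_itv/=.
      by move=> [/andP[? ?] [|] /andP[? ?]]; apply/andP; split; lra.
    by move=> /andP[? ?]; split; [|right]; apply/andP; split; lra.
  split; first exact: measurable_itv.
  have -> : b - a = b - L%:num - (a - L%:num) by ring.
  by apply: itv; rewrite ltrD2r.
(* The interval straddles L; its two pieces are disjoint because b - L <= a. *)
have -> : cell s i = `[a, L%:num[%classic `|` `[0, b - L%:num[%classic.
  rewrite cE; apply/seteqP; split=> x /=; rewrite !in_itv/=.
    move=> [/andP[? ?] [|] /andP[? ?]]; [left|right]; apply/andP; split; lra.
  move=> [|] /andP[? ?]; (split; first by apply/andP; split; lra).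
    by left; apply/andP; split; lra.
  by right; apply/andP; split; lra.
split; first by apply: measurableU; exact: measurable_itv.
rewrite measureU; [|exact: measurable_itv|exact: measurable_itv|].
  transitivity ((L%:num - a)%:E + (b - L%:num - 0)%:E)%E.
    by congr (_ + _)%E; apply: itv; rewrite ?subr_gt0.
  by rewrite -EFinD (_ : L%:num - a + (b - L%:num - 0) = b - a)//; ring.
apply/seteqP; split=> x //= []; rewrite !in_itv/= => /andP[? ?] /andP[? ?].
lra.
Qed.

(** The first coordinate carries [j], the index of the tangent line, and the second [i], the index
    of the point, as in [TP] and [discrete_sum]. *)
Definition step_fun n s w (z : R * R) : R :=
  \sum_(i < n) \sum_(j < n) w i j * \1_(cell s j `*` cell s i) z.

Lemma step_funE n s w i j z : cyclic_partition L n s -> (i < n)%N -> (j < n)%N ->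
  cell s j z.1 -> cell s i z.2 -> step_fun n s w z = w i j.
Proof.
move=> ps ni nj cj ci; rewrite /step_fun (bigD1 (Ordinal ni))//=.
rewrite (bigD1 (Ordinal nj))//= indicE mem_set// mulr1.
rewrite !big1 ?addr0// => [a ai|b bj].
  rewrite big1// => b _; rewrite indicE memNset ?mulr0// => -[_] /= ca.
  by move/eqP: ai; apply; apply: val_inj; exact: (cell_uniq ps (ltn_ord a) ni ca ci).
rewrite indicE memNset ?mulr0// => -[/= cb _].
by move/eqP: bj; apply; apply: val_inj; exact: (cell_uniq ps (ltn_ord b) nj cb cj).
Qed.

Lemma measurable_rect n s i j : cyclic_partition L n s -> (i < n)%N -> (j < n)%N ->
  measurable (cell s j `*` cell s i).
Proof.
move=> ps ni nj; apply: measurableX; [exact: (cell_measure ps nj).1|].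
exact: (cell_measure ps ni).1.
Qed.

Lemma measurable_step_fun n s w D : cyclic_partition L n s ->
  measurable_fun D (step_fun n s w).
Proof.
move=> ps; apply: measurable_sum => i; apply: measurable_sum => j.
apply: measurable_funM; first exact: measurable_cst.
apply: measurable_indic; exact: (measurable_rect ps (ltn_ord i) (ltn_ord j)).
Qed.

Notation DD := (`[0, L%:num[%classic `*` `[0, L%:num[%classic : set (R * R)).

Lemma measurable_DD : measurable DD.
Proof. by apply: measurableX; exact: measurable_itv. Qed.

Lemma integral_step_fun n s w : cyclic_partition L n s -> (forall i j, 0 <= w i j) ->
  (\int[mu \x mu]_(z in DD) (step_fun n s w z)%:E)%E =
  (\sum_(i < n) \sum_(j < n) w i j * (s i.+1 - s i) * (s j.+1 - s j))%:E.
Proof.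
move=> ps w0; have mDD := measurable_DD.
have mI (i j : 'I_n) : measurable_fun DD (fun z => (w i j * \1_(cell s j `*` cell s i) z)%:E).
  apply/measurable_EFinP; apply: measurable_funM; first exact: measurable_cst.
  apply: measurable_indic; exact: (measurable_rect ps (ltn_ord i) (ltn_ord j)).
have I0 (i j : 'I_n) z : (0 <= (w i j * \1_(cell s j `*` cell s i) z)%:E)%E.
  by rewrite lee_fin mulr_ge0// indicE.
rewrite /step_fun; under eq_integral do (rewrite -sumEFin; under eq_bigr do rewrite -sumEFin).
rewrite ge0_integral_sum//; first last.
- by move=> i z _; apply: sume_ge0.
- by move=> i; apply: emeasurable_sum => j; exact: mI.
rewrite -sumEFin; apply: eq_bigr => i _.
rewrite ge0_integral_sum//; last by move=> j; exact: mI.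
rewrite -sumEFin; apply: eq_bigr => j _.
under eq_integral do rewrite EFinM.
have mr := measurable_rect ps (ltn_ord i) (ltn_ord j).
have [mi ei] := cell_measure ps (ltn_ord i); have [mj ej] := cell_measure ps (ltn_ord j).
rewrite ge0_integralZl_EFin//; last first.
  by apply/measurable_EFinP; apply: measurable_indic.
rewrite integral_indic// (_ : _ `&` _ = cell s j `*` cell s i); last first.
  by apply/setIidl => -[x y] [[xL _] [yL _]]; split => /=; rewrite in_itv.
transitivity ((w i j)%:E * (mu (cell s j) * mu (cell s i)))%E.
  by congr (_ * _)%E; exact: product_measure1E.
by rewrite ei ej -!EFinM mulrAC mulrA.
Qed.

End step_functions.

Arguments cell {R} L s i _.
Arguments step_fun {R} L n s w z.

(** * Selection of sample points by averaging *)

Section averaging.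
Context {R : realType}.
Local Open Scope ereal_scope.
Implicit Types (u : R -> \bar R) (Phi : R * R -> \bar R) (I : nat -> set R) (D : set R).

Notation mu := (@lebesgue_measure R).

(** Otherwise c u exceeds the integral plus e throughout D, and integrating over D, of measure c,
    gives a contradiction. The slack e makes the non-strict monotonicity of the integral
    sufficient. *)
Lemma exists_le_average D u (c e : R) : measurable D -> mu D = c%:E ->
  (0 < c)%R -> (0 < e)%R -> measurable_fun D u -> (forall x, D x -> 0 <= u x) ->
  exists2 x, D x & c%:E * u x <= \int[mu]_(x in D) u x + e%:E.
Proof.
move=> mD Dc c0 e0 mu0 u0.
have D0 : D !=set0.
  by apply/set0P/eqP => D0; move: Dc; rewrite D0 measure0 => -[] /eqP; rewrite lt_eqF.
apply: contrapT => H.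
have {}H x : D x -> \int[mu]_(x in D) u x + e%:E < c%:E * u x.
  by move=> Dx; rewrite ltNge; apply/negP => h; apply: H; exists x.
have J0 : 0 <= \int[mu]_(x in D) u x by exact: integral_ge0.
have [x0 Dx0] := D0.
have Jfin : \int[mu]_(x in D) u x \is a fin_num.
  have [//|] := boolP (_ \is a fin_num); rewrite ge0_fin_numE// -leNgt leye_eq => /eqP J.
  by have := H x0 Dx0; rewrite J addye// ltNge leey.
have : \int[mu]_(x in D) cst (\int[mu]_(x in D) u x + e%:E) x <=
       \int[mu]_(x in D) (c%:E * u x).
  apply: ge0_le_integral => //.
  - by move=> x Dx; rewrite adde_ge0// lee_fin ltW.
  - by apply: emeasurable_funM => //; exact: measurable_cst.
  - by move=> x Dx; exact/ltW/H.
rewrite integral_cst// [X in _ * X <= _](_ : _ = c%:E)//.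
rewrite ge0_integralZl_EFin//; last exact: ltW.
move: J0 Jfin; case: (\int[mu]_(x in D) u x) => // r _ _.
rewrite -EFinD -!EFinM lee_fin mulrC ler_pM2l// leNgt.
by rewrite ltrDl e0.
Qed.

Lemma measurable_section1 Phi x : measurable_fun setT Phi ->
  measurable_fun setT (fun y => Phi (y, x)).
Proof. by move=> mP; apply: (measurableT_comp mP); exact: pair2_measurable. Qed.

Lemma measurable_integral1 Phi D : measurable D -> measurable_fun setT Phi ->
  (forall z, 0 <= Phi z) ->
  measurable_fun setT (fun x => \int[mu]_(y in D) Phi (y, x)).
Proof.
move=> mD mP P0; pose f := Phi \_ (D `*` setT).
have mf : measurable_fun setT f.
  apply/(measurable_restrictT _ _).1; first exact: measurableX.
  exact: measurable_funTS.
have f0 z : 0 <= f z by exact: erestrict_ge0.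
have := measurable_fun_fubini_tonelli_G (m1 := mu) f mf f0.
congr measurable_fun; apply/funext => x; rewrite /fubini_G [RHS]integral_mkcond.
apply: eq_integral => y _; rewrite /f !patchE.
have [yD|yD] := boolP (y \in D).
  by rewrite ifT//; apply/mem_set; split => //=; exact: set_mem.
rewrite ifF//; apply/negbTE; apply: contra yD => /set_mem[/= yD _].
exact: mem_set.
Qed.

Lemma tonelli_square Phi D : measurable D -> measurable_fun setT Phi ->
  (forall z, 0 <= Phi z) ->
  \int[mu \x mu]_(z in D `*` D) Phi z =
  \int[mu]_(x in D) \int[mu]_(y in D) Phi (y, x).
Proof.
move=> mD mP P0; pose f := Phi \_ (D `*` D).
have mf : measurable_fun setT f.
  apply/(measurable_restrictT _ _).1; first exact: measurableX.
  exact: measurable_funTS.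
have f0 z : 0 <= f z by exact: erestrict_ge0.
rewrite integral_mkcond -/f [RHS]integral_mkcond.
apply: eq_trans (fubini_tonelli2 (m1 := mu) (m2 := mu) f mf f0) _.
apply: eq_integral => x _; rewrite /fubini_G patchE.
have [xD|xD] := boolP (x \in D); last first.
  apply: integral0_eq => y _; rewrite /f patchE ifF//.
  by apply/negbTE; apply: contra xD => /set_mem[_ /= xD]; exact: mem_set.
rewrite [RHS]integral_mkcond; apply: eq_integral => y _; rewrite /f !patchE.
have [yD|yD] := boolP (y \in D).
  by rewrite ifT//; apply/mem_set; split => /=; exact: set_mem.
rewrite ifF//; apply/negbTE; apply: contra yD => /set_mem[/= yD _].
exact: mem_set.
Qed.

(* Method of conditional expectations: the points are chosen one at a time, the
   last one first, each time without exceeding the average by more than e. *)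
Lemma exists_le_pair_average Phi (c e : R) I : measurable_fun setT Phi ->
  (forall z, 0 <= Phi z) -> (0 < c)%R -> (0 < e)%R ->
  (forall i, measurable (I i)) -> (forall i, mu (I i) = c%:E) ->
  forall n (u : nat -> R -> \bar R), (forall i, measurable_fun setT (u i)) ->
  (forall i x, 0 <= u i x) -> exists x : nat -> R,
    (forall i, (i < n)%N -> I i (x i)) /\
    \sum_(i < n) c%:E * u i (x i) +
      \sum_(i < n) \sum_(j < i) (c ^+ 2)%:E * Phi (x j, x i) <=
    \sum_(i < n) \int[mu]_(y in I i) u i y +
      \sum_(i < n) \sum_(j < i) \int[mu]_(y in I i) \int[mu]_(z in I j) Phi (z, y)
      + (n%:R * e)%:E.
Proof.
move=> mP P0 c0 e0 mI Ic; elim=> [|n IH] u mu_ u0.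
  by exists (fun=> 0%R); split=> //; rewrite !big_ord0 mul0r !adde0.
pose K j x := \int[mu]_(y in I j) Phi (y, x).
have mK j : measurable_fun setT (K j) by exact: measurable_integral1.
have K0 j x : 0 <= K j x by exact: integral_ge0.
(* The conditional cost of the last point: its own weight and, for each earlier index, the
   integrated interaction with a point still to be chosen. *)
pose Psi x := u n x + \sum_(j < n) K j x.
have mPsi : measurable_fun setT Psi.
  by apply: emeasurable_funD => //; apply: emeasurable_sum => j.
have Psi0 x : 0 <= Psi x by rewrite adde_ge0// sume_ge0.
have [xn Ixn Hxn] := exists_le_average (mI n) (Ic n) c0 e0
  (measurable_funTS mPsi) (fun x _ => Psi0 x).
(* Once the last point is fixed, its interactions become weights of single points; the general [u]
   in the induction is there to absorb them. *)
pose v j y := u j y + c%:E * Phi (y, xn).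
have c0' : 0 <= c%:E by rewrite lee_fin ltW.
have mP1 : measurable_fun setT (fun y => Phi (y, xn)) by exact: measurable_section1.
have mc : measurable_fun setT (fun y => c%:E * Phi (y, xn)).
  by apply: emeasurable_funM; [exact: measurable_cst|exact: mP1].
have [|i y|x [xI Hx]] := IH v.
- by move=> i; apply: emeasurable_funD => //; exact: mc.
- by rewrite adde_ge0// mule_ge0.
exists (fun i => if i == n then xn else x i); split.
  move=> i; rewrite ltnS leq_eqVlt => /orP[/eqP->|ni]; first by rewrite eqxx.
  by rewrite (ltn_eqF ni); exact: xI.
rewrite !big_ord_recr/= eqxx.
have E1 : \sum_(i < n) c%:E * u i (if i == n :> nat then xn else x i) =
          \sum_(i < n) c%:E * u i (x i).
  by apply: eq_bigr => i _; rewrite ltn_eqF.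
have E2 : \sum_(i < n) \sum_(j < i) (c ^+ 2)%:E *
      Phi (if j == n :> nat then xn else x j, if i == n :> nat then xn else x i) =
    \sum_(i < n) \sum_(j < i) (c ^+ 2)%:E * Phi (x j, x i).
  apply: eq_bigr => i _; apply: eq_bigr => j _.
  by rewrite !ltn_eqF// (ltn_trans (ltn_ord j)).
have E3 : \sum_(j < n) (c ^+ 2)%:E * Phi (if j == n :> nat then xn else x j, xn) =
    \sum_(j < n) c%:E * (c%:E * Phi (x j, xn)).
  by apply: eq_bigr => i _; rewrite ltn_eqF// muleA -EFinM expr2.
rewrite {}E1 {}E2 {}E3.
have S1 : \sum_(i < n) c%:E * v i (x i) = \sum_(i < n) c%:E * u i (x i) +
    \sum_(j < n) c%:E * (c%:E * Phi (x j, xn)).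
  rewrite -big_split; apply: eq_bigr => i _; rewrite ge0_muleDr// mule_ge0//.
have S2 : \sum_(i < n) \int[mu]_(y in I i) v i y =
    \sum_(i < n) \int[mu]_(y in I i) u i y + c%:E * \sum_(j < n) K j xn.
  rewrite ge0_sume_distrr; last by move=> i _.
  rewrite -big_split; apply: eq_bigr => i _; rewrite ge0_integralD//.
  - congr (_ + _); rewrite ge0_integralZl_EFin//; first exact: mI.
    exact: measurable_funTS mP1.
  - exact: mI.
  - exact: measurable_funTS (mu_ i).
  - by move=> y _; rewrite mule_ge0.
  - exact: measurable_funTS mc.
have S3 : \int[mu]_(x in I n) Psi x = \int[mu]_(x in I n) u n x +
    \sum_(j < n) \int[mu]_(y in I n) K j y.
  rewrite ge0_integralD//; first last.
  - by apply: emeasurable_sum => j; exact: measurable_funTS (mK j).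
  - by move=> y _; rewrite sume_ge0.
  - exact: measurable_funTS (mu_ n).
  - exact: mI.
  congr (_ + _); rewrite ge0_integral_sum//; first exact: mI.
  by move=> j; exact: measurable_funTS (mK j).
rewrite S1 S2 in Hx; rewrite S3 {1}/Psi ge0_muleDr ?sume_ge0// in Hxn.
have := leeD Hx Hxn.
set a1 := \sum_(i < n) c%:E * u i (x i); set a2 := \sum_(j < n) c%:E * (_ * _).
set a3 := \sum_(i < n) \sum_(j < i) (_ * _); set b1 := \sum_(i < n) \int[mu]_(y in I i) u i y.
set b2 := c%:E * \sum_(j < n) K j xn; set b3 := \sum_(i < n) \sum_(j < i) _.
set a4 := c%:E * u n xn; set b4 := \int[mu]_(x in I n) u n x.
set b5 := \sum_(j < n) \int[mu]_(y in I n) K j y.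
have b20 : 0 <= b2 by rewrite mule_ge0// sume_ge0.
have b40 : 0 <= b4 by exact: integral_ge0.
have b50 : 0 <= b5 by apply: sume_ge0 => j _; exact: integral_ge0.
have a40 : 0 <= a4 by rewrite mule_ge0.
have b10 : 0 <= b1 by apply: sume_ge0 => j _; exact: integral_ge0.
have b30 : 0 <= b3.
  apply: sume_ge0 => i _; apply: sume_ge0 => j _; apply: integral_ge0 => y _.
  exact: integral_ge0.
(* [b2], the integrated interactions of the chosen point, occurs on both sides of the added
   inequalities. It is finite, hence cancels, unless the upper bound is infinite anyway. *)
have [b45|b45] := eqVneq (b4 + b5) +oo.
  move=> _; rewrite (_ : b1 + b4 + (b3 + b5) = b1 + b3 + (b4 + b5)); last by rewrite addeACA.
  by rewrite b45 addey ?leey// gt_eqF// (@lt_le_trans _ _ 0) ?adde_ge0.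
have b2f : b2 \is a fin_num.
  rewrite ge0_fin_numE//; apply: (@le_lt_trans _ _ (a4 + b2)); first by rewrite leeDr.
  apply: (le_lt_trans Hxn).
  by apply: lte_add_pinfty; rewrite ?ltry// ltey b45.
rewrite [leLHS](AC (3*2) (((1*4)*(3*2))*5)) [leRHS](AC (4*3) ((((1*5)*(3*6))*(4*7))*2))/=.
by rewrite leeD2rE// -EFinD -[X in (_ + X)%:E]mul1r -mulrDl natr1.
Qed.

Lemma integral_disjoint_le u I D n : measurable D -> (forall i, measurable (I i)) ->
  (forall i, (i < n)%N -> I i `<=` D) -> trivIset setT I ->
  measurable_fun setT u -> (forall x, 0 <= u x) ->
  \sum_(i < n) \int[mu]_(x in I i) u x <= \int[mu]_(x in D) u x.
Proof.
move=> mD mI ID tI mu_ u0.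
have mB : measurable (\big[setU/set0]_(i < n) I i) by apply: bigsetU_measurable => i _; exact: mI.
rewrite -(big_mkord xpredT (fun i => \int[mu]_(x in I i) u x)).
have E := @ge0_integral_bigsetU _ _ _ mu nat I u (index_iota 0 n) mI (iota_uniq _ _)
  (sub_trivIset (@subsetT _ _) tI) (measurable_funTS mu_) (fun x _ => u0 x).
rewrite -E big_mkord; apply: ge0_subset_integral => //; first exact: measurable_funTS mu_.
by move=> x; rewrite -bigcup_mkord => -[i ni]; exact: ID.
Qed.

Lemma exists_le_pair_integral Phi (c e : R) I D n : measurable_fun setT Phi ->
  (forall z, 0 <= Phi z) -> (0 < c)%R -> (0 < e)%R ->
  (forall i, measurable (I i)) -> (forall i, mu (I i) = c%:E) ->
  measurable D -> (forall i, (i < n)%N -> I i `<=` D) -> trivIset setT I ->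
  exists x : nat -> R, (forall i, (i < n)%N -> I i (x i)) /\
    \sum_(i < n) \sum_(j < i) (c ^+ 2)%:E * Phi (x j, x i) <=
    \int[mu \x mu]_(z in D `*` D) Phi z + e%:E.
Proof.
move=> mP P0 c0 e0 mI Ic mD ID tI.
(* The slack is spent once per point; n shares of e / (n + 1) stay below e. *)
have en0 : (0 < e / n.+1%:R)%R by rewrite divr_gt0// ltr0n.
have [||x [xI]] := @exists_le_pair_average Phi c _ I mP P0 c0 en0 mI Ic n (fun _ => cst 0).
- by move=> i; exact: measurable_cst.
- by [].
rewrite big1 => [|i _]; last by rewrite mule0.
rewrite add0e [X in _ <= X + _ + _]big1 => [|i _]; last by rewrite integral0.
rewrite add0e => H; exists x; split=> //; apply: (le_trans H); apply: leeD; last first.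
  rewrite lee_fin mulrCA ger_pMr// ler_pdivrMr ?ltr0n// mul1r ler_nat.
  exact: leqnSn.
rewrite tonelli_square//.
pose K j x := \int[mu]_(y in I j) Phi (y, x).
have K0 j y : 0 <= K j y by exact: integral_ge0.
have mK j : measurable_fun setT (K j) by exact: measurable_integral1.
pose V x := \int[mu]_(y in D) Phi (y, x).
have mV : measurable_fun setT V by exact: measurable_integral1.
have V0 y : 0 <= V y by exact: integral_ge0.
apply: le_trans (integral_disjoint_le mD mI ID tI mV V0).
(* The pairs j >= i, diagonal rectangles included, are added back; nonnegativity and disjointness
   then bound the sum by the integral over the whole square. *)
apply: lee_sum => i _; apply: (@le_trans _ _ (\int[mu]_(y in I i) \sum_(j < n) K j y)).
  rewrite ge0_integral_sum//; [|exact: mI|by move=> j; exact: measurable_funTS (mK j)].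
  rewrite -[leRHS](big_mkord xpredT (fun j => \int[mu]_(x in I i) K j x)).
  rewrite (@big_cat_nat _ _ _ i 0 n)//=; last exact: ltnW.
  rewrite big_mkord leeDl//; apply: sume_ge0 => j _; exact: integral_ge0.
apply: ge0_le_integral.
- exact: mI.
- by move=> y _; apply: sume_ge0.
- by apply: emeasurable_sum => j; exact: measurable_funTS (mK j).
- exact: measurable_funTS mV.
- move=> y _; apply: integral_disjoint_le => //; exact: measurable_section1.
Qed.

End averaging.

(** * Lower and upper limits of extended real sequences *)

Section limits.
Context {R : realType}.
Local Open Scope ereal_scope.
Implicit Types (u v : (\bar R)^nat) (c : \bar R).

Lemma limn_einf_sup u : limn_einf u = ereal_sup (range (einfs u)).
Proof. by rewrite limn_einf_lim; apply/cvg_lim => //; exact: cvg_einfs_sup. Qed.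

Lemma einfs_le u n k : (n <= k)%N -> einfs u n <= u k.
Proof. by move=> nk; apply: ereal_inf_lbound; exists k. Qed.

Lemma limn_einf_ge u c : (exists N, forall n, (N <= n)%N -> c <= u n) ->
  c <= limn_einf u.
Proof.
move=> [N H]; rewrite limn_einf_sup; apply: (@le_trans _ _ (einfs u N)).
  by apply: le_ereal_inf_tmp => _ [k /= Nk <-]; exact: H.
by apply: ereal_sup_ubound; exists N.
Qed.

Lemma limn_esup_le u c : (exists N, forall n, (N <= n)%N -> u n <= c) ->
  limn_esup u <= c.
Proof.
move=> [N H]; have := @limn_einf_ge (-%E \o u) (- c).
rewrite limn_einfN leeN2; apply; exists N => n Nn.
by rewrite /= leeN2 H.
Qed.

Lemma limn_einf_le u v : (exists N, forall n, (N <= n)%N -> u n <= v n) ->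
  limn_einf u <= limn_einf v.
Proof.
move=> [N H]; rewrite limn_einf_sup; apply: ge_ereal_sup => _ [m _ <-].
apply: limn_einf_ge; exists (maxn m N) => n; rewrite geq_max => /andP[mn Nn].
exact: le_trans (einfs_le u mn) (H n Nn).
Qed.

End limits.

(** * Measurability and convergence of the integrand *)

Section tp_integrand.
Context {R : realType}.
Implicit Types (q : R).

Lemma measurable_dotv d (T : measurableType d) (u v : T -> 'rV[R]_3) :
  (forall i, measurable_fun setT (fun z => u z 0 i)) ->
  (forall i, measurable_fun setT (fun z => v z 0 i)) ->
  measurable_fun setT (fun z => dotv (u z) (v z)).
Proof.
by move=> mu_ mv; apply: measurable_sum => i; apply: measurable_funM.
Qed.

Lemma measurable_coord (f : R -> 'rV[R]_3) i : continuous f ->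
  measurable_fun setT (fun x => f x 0 i).
Proof.
move=> cf; apply: continuous_measurable_fun => x.
apply: (@cvg_comp _ _ _ f (fun u : 'rV[R]_3 => u 0 i)); first exact: cf.
exact: coord_continuous.
Qed.

Lemma measurable_sqrt : measurable_fun setT (@Num.sqrt R).
Proof. by apply: continuous_measurable_fun; exact: sqrt_continuous. Qed.

Lemma measurable_chord_coord (f : R -> 'rV[R]_3) i : continuous f ->
  measurable_fun setT (fun z : R * R => (f z.2 - f z.1) 0 i).
Proof.
move=> cf; have mc := @measurable_coord f i cf.
rewrite (_ : (fun z => _) = (fun z : R * R => f z.2 0 i - f z.1 0 i)); last first.
  by apply/funext => z; rewrite !mxE.
apply: measurable_funB.
  exact: (measurableT_comp mc measurable_snd).
exact: (measurableT_comp mc measurable_fst).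
Qed.

Lemma measurable_chord (f : R -> 'rV[R]_3) : continuous f ->
  measurable_fun setT (fun z : R * R => enorm (f z.2 - f z.1)).
Proof.
move=> cf; apply: (measurableT_comp measurable_sqrt).
by apply: measurable_dotv => i; exact: measurable_chord_coord.
Qed.

Lemma measurable_tp_quotient (f G : R -> 'rV[R]_3) q : continuous f -> continuous G ->
  (forall x, enorm (G x) = 1) ->
  measurable_fun setT
    (fun z : R * R => (tp_quotient (f z.1) (G z.1) (f z.2)) `^ q).
Proof.
move=> cf cG G1; apply: (measurableT_comp (measurable_powR q)).
pose A (z : R * R) := dotv (f z.2 - f z.1) (f z.2 - f z.1).
pose B (z : R * R) := dotv (f z.2 - f z.1) (G z.1).
have mA : measurable_fun setT A.
  by apply: measurable_dotv => i; exact: measurable_chord_coord.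
have mB : measurable_fun setT B.
  apply: measurable_dotv => i; first exact: measurable_chord_coord.
  exact: (measurableT_comp (measurable_coord i cG) measurable_fst).
(* Division is written as the power -1; at [A z = 0] both are 0, so the identity also holds on the
   diagonal. *)
rewrite (_ : (fun z => _) = (fun z => 2 * Num.sqrt (A z - B z ^+ 2) * (A z) `^ (-1))).
  apply: measurable_funM.
    apply: measurable_funM; first exact: measurable_cst.
    apply: (measurableT_comp measurable_sqrt).
    by apply: measurable_funB => //; exact: measurable_funX.
  exact: (measurableT_comp (measurable_powR (-1)) mA).
by apply/funext => z; rewrite tp_quotientE// powR_inv1// dotv_ge0.
Qed.

Lemma cvg_powR T (F : set_system T) {FF : ProperFilter F} (u : T -> R) (l q : R) :
  0 < q -> (forall z, 0 <= u z) -> 0 <= l -> u @ F --> l ->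
  (u z) `^ q @[z --> F] --> l `^ q.
Proof.
move=> q0 u0 l0 ul.
(* At the limit 0 the logarithm cannot be used; there u < e^(1/q) gives u^q <= e directly. *)
have [l0'|l_neq0] := eqVneq l 0.
  rewrite l0' powR0 ?gt_eqF//; apply/cvgrPdist_le => e e0; rewrite l0' in ul.
  have e1 : 0 < e `^ q^-1 by rewrite powR_gt0.
  move/cvgrPdist_le : ul => /(_ _ e1); apply: filterS => z.
  rewrite !sub0r !normrN !ger0_norm ?powR_ge0// => h.
  rewrite -[e]powRr1 ?(ltW e0)// -(@mulVf _ q) ?gt_eqF// powRrM.
  by rewrite ge0_ler_powR ?nnegrE ?powR_ge0// ltW.
have l_gt0 : 0 < l by rewrite lt_neqAle eq_sym l_neq0.
have cl : expR (q * ln (u z)) @[z --> F] --> expR (q * ln l).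
  have h : q * ln (u z) @[z --> F] --> q * ln l.
    apply: cvgM; first exact: cvg_cst.
    exact: (cvg_comp _ _ ul (continuous_ln l_gt0)).
  exact: (cvg_comp _ _ h (@continuous_expR R _)).
have E a : 0 < a -> a `^ q = expR (q * ln a) by move=> a0; rewrite /powR gt_eqF.
rewrite E//; apply: cvg_trans cl; apply: near_eq_cvg.
have H : \forall z \near F, 0 < u z by exact: (cvgr_gt _ ul _ l_gt0).
by apply: filterS H => z uz; rewrite E.
Qed.

Lemma cvg_diagonal (f_ : nat -> R -> 'rV[R]_3) (f : R -> 'rV[R]_3) (X : nat -> R)
    (d : nat -> R) x : (forall n y, enorm (f_ n y - f y) <= d n) ->
  d @ \oo --> 0 -> continuous f -> X @ \oo --> x -> f_ n (X n) @[n --> \oo] --> f x.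
Proof.
move=> fd d0 cf Xx; have fX : f (X n) @[n --> \oo] --> f x.
  exact: (cvg_comp _ _ Xx (cf x)).
have gX : enorm (f (X n) - f x) @[n --> \oo] --> 0.
  have h : f (X n) - f x @[n --> \oo] --> f x - f x.
    by apply: cvgB => //; exact: cvg_cst.
  by rewrite -(enorm0 R) -(subrr (f x)); exact: cvg_enorm h.
apply: enorm_cvg => e e0; have e20 : 0 < e / 2 by rewrite divr_gt0.
have h1 : \forall n \near \oo, `|d n| <= e / 2 by exact: (cvgr0_norm_le _ d0 _ e20).
have h2 : \forall n \near \oo, `|enorm (f (X n) - f x)| <= e / 2.
  exact: (cvgr0_norm_le _ gX _ e20).
near=> n; rewrite (le_trans (ler_enormB _ _ (f (X n))))// (splitr e) lerD//.
  rewrite (le_trans (fd n _))// (le_trans (ler_norm _))//.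
  by near: n; exact: h1.
rewrite (le_trans (ler_norm _))//.
by near: n; exact: h2.
Unshelve. all: by end_near. Qed.

End tp_integrand.

(** * The liminf inequality by Fatou's lemma *)

Section liminf.
Context {R : realType} {L : {posnum R}}.
Implicit Types (g h : C1ia L) (s : nat -> R) (q e : R).

Notation mu := (@lebesgue_measure R).
Notation DD := (`[0%R, L%:num[%classic `*` `[0%R, L%:num[%classic : set (R * R)).

Definition tp_integrand q g (x y : R) : R :=
  (tp_quotient (g x) (derive1 g x) (g y)) `^ q.

Lemma tp_integrand_ge0 q g x y : 0 <= tp_integrand q g x y.
Proof. exact: powR_ge0. Qed.

Lemma tp_integrand_diag q g x : q != 0 -> tp_integrand q g x x = 0.
Proof. by move=> q0; rewrite /tp_integrand tp_quotient_diag powR0. Qed.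

Lemma tp_integrandD q g x y :
  tp_integrand q g (x + L%:num) y = tp_integrand q g x y /\
  tp_integrand q g x (y + L%:num) = tp_integrand q g x y.
Proof. by rewrite /tp_integrand derive1_C1iaD !curve_periodic. Qed.

Lemma measurable_tp_integrand q g :
  measurable_fun setT (fun z : R * R => tp_integrand q g z.1 z.2).
Proof.
apply: measurable_tp_quotient; first exact: C1ia_continuous.
  exact: curve_continuous_derive.
exact: curve_arclength.
Qed.

(** The diagonal terms are 0 through division by zero, so they may be added; the sum is then the
    integral of a step function over the full square. *)
Lemma discrete_sumE q n g s : q != 0 -> discrete_sum q n g s =
  \sum_(i < n) \sum_(j < n)
    tp_integrand q g (s j) (s i) * (s i.+1 - s i) * (s j.+1 - s j).
Proof.
move=> q0; apply: eq_bigr => i _; rewrite [RHS](bigD1 i)//=.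
by rewrite tp_integrand_diag// !mul0r add0r.
Qed.

Lemma discrete_sum_ge0 q n g s : (forall i, (i < n)%N -> s i <= s i.+1) ->
  0 <= discrete_sum q n g s.
Proof.
move=> sI; apply: sumr_ge0 => i _; apply: sumr_ge0 => j _.
by rewrite !mulr_ge0 ?powR_ge0// /biarc_length subr_ge0 sI.
Qed.

Lemma in_B_partition n g s : in_B n g s -> [/\ (0 < n)%N, cyclic_partition L n s &
  forall i, (i < n)%N -> s i.+1 - s i <= 2 * L%:num / n%:R].
Proof.
move=> [[sn _] sI]; have n0 : (0 < n)%N.
  case: n sn {sI} => // /eqP; rewrite -subr_eq0 opprD addrA subrr sub0r oppr_eq0.
  by rewrite gt_eqF.
split=> // [|i /sI/andP[]//]; split=> // i /sI/andP[h _].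
rewrite -subr_gt0; apply: lt_le_trans h.
by rewrite divr_gt0// mulr_gt0// ltr0n.
Qed.

(** The sample of a cell is close to the points of that cell only modulo L; periodicity of [W]
    allows it to be moved next to them. *)
Lemma step_fun_near n s e (W : R -> R -> R) z : cyclic_partition L n s ->
  (forall i, (i < n)%N -> s i.+1 - s i <= e) ->
  (forall x y, W (x + L%:num) y = W x y /\ W x (y + L%:num) = W x y) -> DD z ->
  exists X Y, [/\ `|z.1 - X| <= e, `|z.2 - Y| <= e &
    step_fun L n s (fun i j => W (s j) (s i)) z = W X Y].
Proof.
move=> ps se pW [/=]; rewrite !in_itv/= => z1 z2.
have [j nj cj] := cell_cover ps z1; have [i ni ci] := cell_cover ps z2.
have [k Hk] := cell_near nj se cj; have [l Hl] := cell_near ni se ci.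
exists (s j + k%:~R * L%:num), (s i + l%:~R * L%:num); split=> //.
rewrite (step_funE _ ps ni nj cj ci).
rewrite (periodicZ (f := fun x => W x _) (fun x => (pW x _).1)).
by rewrite (periodicZ (f := W _) (fun y => (pW _ y).2)).
Qed.

Lemma C1ia_injective0 g x y : 0 <= x < L%:num -> 0 <= y < L%:num -> g x = g y -> x = y.
Proof.
move=> /andP[x0 x1] /andP[y0 y1] /curve_injective[k xy].
have k1 : k%:~R * L%:num < 1 * L%:num by rewrite -xy; lra.
have k2 : -1 * L%:num < k%:~R * L%:num by rewrite -xy; lra.
rewrite ltr_pM2r// in k1; rewrite ltr_pM2r// in k2.
have k0 : k = 0.
  rewrite -[1]/(1%:~R) ltr_int in k1; rewrite (_ : -1 = (-1)%:~R)// ltr_int in k2.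
  by move: k1 k2; lia.
by move: xy; rewrite k0 mul0r => /subr0_eq.
Qed.

Lemma cvg_of_mesh (k : nat -> nat) (X : nat -> R) x a : 0 < a ->
  (forall n, (n <= k n)%N) -> (forall n, `|x - X n| <= a / (k n)%:R) -> X @ \oo --> x.
Proof.
move=> a0 nk H; apply/cvgrPdist_le => e e0; have [N HN] := mesh_small a0 e0.
exists N => // n /= Nn; apply: (le_trans (H n)).
by have [_] := HN (k n) (leq_trans Nn (nk n)).
Qed.

Lemma cvg_tp_integrand q (h_ : nat -> C1ia L) g (X Y : nat -> R) x y : 0 < q ->
  h_ @ \oo --> g -> X @ \oo --> x -> Y @ \oo --> y -> g x <> g y ->
  tp_integrand q (h_ n) (X n) (Y n) @[n --> \oo] --> tp_integrand q g x y.
Proof.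
move=> q0 hg Xx Yy gxy.
have dg : C1dist (h_ n) g @[n --> \oo] --> 0.
  apply/cvgrPdist_le => e e0.
  have /cvg_ballP/(_ e e0) := hg.
  apply: filterS => n /= H; rewrite sub0r normrN C1dist_sym.
  rewrite ger0_norm; first exact: ltW H.
  have := C1dist_ge g (h_ n) 0 => -[h1 _]; exact: le_trans (enorm_ge0 _) h1.
have c1 Z z : Z @ \oo --> z -> h_ n (Z n) @[n --> \oo] --> g z.
  apply: (@cvg_diagonal R (fun n => curve_fun (h_ n)) g Z _ z _ dg) => [n t|].
    exact: (C1dist_ge (h_ n) g t).1.
  exact: C1ia_continuous.
have c2 : derive1 (h_ n) (X n) @[n --> \oo] --> derive1 g x.
  apply: (@cvg_diagonal R (fun n => derive1 (h_ n)) (derive1 g) X _ x _ dg) => [n t||//].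
    exact: (C1dist_ge (h_ n) g t).2.
  exact: curve_continuous_derive.
apply: cvg_powR => //.
- by move=> n; apply: tp_quotient_ge0; exact: curve_arclength.
- by apply: tp_quotient_ge0; exact: curve_arclength.
apply: cvg_tp_quotient => //; [exact: curve_arclength| |exact: c1|exact: c1].
by move=> n; exact: curve_arclength.
Qed.

Lemma discrete_TP_ge0 q n g : (0 <= discrete_TP q n g)%E.
Proof.
apply: le_ereal_inf_tmp => _ [s sB <-]; rewrite lee_fin.
have [_ ps _] := in_B_partition sB.
by apply: discrete_sum_ge0 => i /ps.2/ltW.
Qed.

Lemma discrete_TP_liminf q (h_ : nat -> C1ia L) g : 0 < q -> h_ @ \oo --> g ->
  (TP q g <= limn_einf (fun n => discrete_TP q n (h_ n)))%E.
Proof.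
move=> q0 hg; have qn0 : q != 0 by rewrite gt_eqF.
have L0 : 0 < L%:num :> R by [].
pose P n := exists s, in_B n (h_ n) s.
(* The discrete energy is an infimum over decompositions, so one within 1 / n of it is taken; the
   error vanishes in the limit. *)
have /choice[S HS] : forall n, exists s, P n -> in_B n (h_ n) s /\
    ((discrete_sum q n (h_ n) s)%:E <= discrete_TP q n (h_ n) + (1 / n%:R)%:E)%E.
  move=> n; have [[s0 s0B]|nP] := pselect (P n); last by exists (fun=> 0).
  have n0 : 0 < (1 / n%:R : R).
    by rewrite divr_gt0// ltr0n; have [] := in_B_partition s0B.
  have fin : discrete_TP q n (h_ n) \is a fin_num.
    rewrite ge0_fin_numE ?discrete_TP_ge0//; apply: (@le_lt_trans _ _ (discrete_sum q n (h_ n) s0)%:E).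
      by apply: ereal_inf_lbound; exists s0.
    exact: ltry.
  have [_ [s sB <-] /ltW H] := lb_ereal_inf_adherent n0 fin.
  by exists s.
pose W n x y := tp_integrand q (h_ n) x y.
pose st n z := step_fun L n (S n) (fun i j => W n (S n j) (S n i)) z.
(* Curves outside the class receive the constant +oo, which is also their energy; no subsequence has
   to be extracted. *)
pose H n z := if `[< P n >] then (st n z)%:E else +oo%E.
have H0 n z : (0 <= H n z)%E.
  rewrite /H; case: ifP => // _; rewrite lee_fin; apply: sumr_ge0 => i _.
  by apply: sumr_ge0 => j _; rewrite mulr_ge0 ?tp_integrand_ge0// indicE.
have mH n : measurable_fun DD (H n).
  rewrite /H; case: asboolP => [/HS[/in_B_partition[_ ps _] _]|_]; last exact: measurable_cst.
  by apply/measurable_EFinP; apply: measurable_step_fun ps.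
have iH n : (\int[mu \x mu]_(z in DD) H n z <= discrete_TP q n (h_ n) + (1 / n%:R)%:E)%E.
  rewrite /H; case: asboolP => [/HS[/in_B_partition[_ ps _] H1]|nP].
    apply: le_trans H1; rewrite discrete_sumE// /st integral_step_fun//.
    by move=> i j; exact: tp_integrand_ge0.
  suff -> : discrete_TP q n (h_ n) = +oo%E by rewrite addye ?leey.
  have E : [set (discrete_sum q n (h_ n) s)%:E | s in in_B n (h_ n)] = set0.
    by apply/seteqP; split=> // x [s sB _]; case: nP; exists s.
  by rewrite /discrete_TP E ereal_inf0.
have lim z : DD z -> ((tp_integrand q g z.1 z.2)%:E <= limn_einf (H ^~ z))%E.
  (* On the diagonal the limit integrand is 0, so nonnegativity of [H] suffices. *)
  move=> Dz; have [z12|z12] := eqVneq z.1 z.2.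
    by rewrite z12 tp_integrand_diag//; apply: limn_einf_ge; exists 0%N.
  have a0 : 0 < 2 * L%:num by rewrite mulr_gt0.
  (* Where [P n] fails, z itself is a dummy value that keeps both sequences convergent to the
     coordinates of z. *)
  have /choice[XY HXY] : forall n, exists XY : R * R, [/\ `|z.1 - XY.1| <= 2 * L%:num / n%:R,
      `|z.2 - XY.2| <= 2 * L%:num / n%:R & P n -> st n z = W n XY.1 XY.2].
    move=> n; have [/[dup] pn /HS[/in_B_partition[_ ps se] _]|nP] := pselect (P n); last first.
      by exists z; rewrite !subrr normr0 divr_ge0// ltW.
    have [X [Y [h1 h2 h3]]] := step_fun_near ps se (tp_integrandD q (h_ n)) Dz.
    by exists (X, Y).
  have cX : (XY n).1 @[n --> \oo] --> z.1.
    by apply: (cvg_of_mesh (k := id) a0) => // n; have [] := HXY n.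
  have cY : (XY n).2 @[n --> \oo] --> z.2.
    by apply: (cvg_of_mesh (k := id) a0) => // n; have [] := HXY n.
  have gz : g z.1 <> g z.2.
    move: Dz => [/=]; rewrite !in_itv/= => z1 z2 gz.
    by move/eqP: z12; apply; exact: (C1ia_injective0 z1 z2 gz).
  have cW := cvg_tp_integrand q0 hg cX cY gz.
  apply/lee_subgt0Pr => e e0; apply: limn_einf_ge.
  move/cvgrPdist_le : cW => /(_ _ e0)[N _ HN]; exists N => n Nn.
  rewrite /H; case: asboolP => [pn|_]; last by rewrite leey.
  have [_ _ /(_ pn) ->] := HXY n; rewrite -EFinB lee_fin.
  by have := HN n Nn; rewrite /W ler_norml => /andP[_]; rewrite lerBlDr lerBlDl.
have mDD := @measurable_DD R L.
apply/lee_addgt0Pr => e e0.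
apply: (@le_trans _ _ (\int[mu \x mu]_(z in DD) limn_einf (H ^~ z))%E).
  apply: ge0_le_integral => //.
  - by move=> z _; rewrite lee_fin tp_integrand_ge0.
  - apply/measurable_EFinP/measurable_funTS; exact: measurable_tp_integrand.
  - rewrite (_ : (fun z => _) = (fun z => - limn_esup ((fun n x => - H n x) ^~ z)))%E//.
    apply: measurableT_comp => //; apply: measurable_fun_limn_esup => n.
    exact: measurableT_comp (mH n).
apply: (@le_trans _ _ (limn_einf (fun n => \int[mu \x mu]_(z in DD) H n z)%E)).
  by apply: fatou.
rewrite addeC -limn_einf_shift//; apply: limn_einf_le.
have [N HN] := mesh_small ltr01 e0; exists N => n Nn.
rewrite (le_trans (iH n))// addeC leeD2r// lee_fin.
by have [] := HN n Nn.
Qed.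

End liminf.

(** * Splitting the integrand by a cutoff; Riemann sums of the far part *)

Section limsup_tools.
Context {R : realType} {L : {posnum R}}.
Implicit Types (g : C1ia L) (s : nat -> R) (q e r : R) (m n : nat).

Notation mu := (@lebesgue_measure R).
Notation DD := (`[0%R, L%:num[%classic `*` `[0%R, L%:num[%classic : set (R * R)).

(** A ramp from 0 at r = 1 / m to 1 at r = 2 / m. It is continuous, unlike an indicator, so that the
    far part is continuous and its Riemann sums converge. *)
Definition cutoff m r : R := Num.max 0 (Num.min 1 (m%:R * r - 1)).

Lemma cutoff_ge0 m r : 0 <= cutoff m r.
Proof. by rewrite le_max lexx. Qed.

Lemma cutoff_le1 m r : cutoff m r <= 1.
Proof. by rewrite ge_max ler01 ge_min lexx. Qed.

Lemma cutoff_eq0 m r : m%:R * r <= 1 -> cutoff m r = 0.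
Proof. by move=> h; apply: max_idPl; rewrite ge_min subr_le0 h orbT. Qed.

Lemma cutoff_eq1 m r : 2 <= m%:R * r -> cutoff m r = 1.
Proof.
by move=> h; rewrite /cutoff min_l; [rewrite max_r|lra].
Qed.

Lemma continuous_cutoff m : continuous (cutoff m).
Proof.
move=> r; have h : {for r, continuous (fun r => m%:R * r - 1)}.
  by apply: cvgB; [apply: cvgM => //; exact: cvg_cst|exact: cvg_cst].
have h1 : {for r, continuous (cst 1 : R -> R)} by exact: cvg_cst.
have h0 : {for r, continuous (cst 0 : R -> R)} by exact: cvg_cst.
have h2 := @continuous_min R _ (cst 1) (fun r => m%:R * r - 1) r h1 h.
exact: (@continuous_max R _ (cst 0) _ r h0 h2).
Qed.

(** The cutoff acts on chords, not on parameter differences: chords are periodic in both arguments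
    and vanish exactly on the diagonal modulo L. *)
Definition tp_far q g m (x y : R) : R :=
  tp_integrand q g x y * cutoff m (enorm (g y - g x)).

Definition tp_near q g m (x y : R) : R :=
  tp_integrand q g x y * (1 - cutoff m (enorm (g y - g x))).

Lemma tp_far_near q g m x y : tp_integrand q g x y = tp_far q g m x y + tp_near q g m x y.
Proof. by rewrite /tp_far /tp_near; ring. Qed.

Lemma tp_far_ge0 q g m x y : 0 <= tp_far q g m x y.
Proof. by rewrite mulr_ge0 ?tp_integrand_ge0 ?cutoff_ge0. Qed.

Lemma tp_near_ge0 q g m x y : 0 <= tp_near q g m x y.
Proof. by rewrite mulr_ge0 ?tp_integrand_ge0// subr_ge0 cutoff_le1. Qed.

Lemma tp_far_le q g m x y : tp_far q g m x y <= tp_integrand q g x y.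
Proof. by rewrite ler_piMr ?tp_integrand_ge0 ?cutoff_le1. Qed.

Lemma tp_near_le q g m x y : tp_near q g m x y <= tp_integrand q g x y.
Proof. by rewrite ler_piMr ?tp_integrand_ge0// gerBl cutoff_ge0. Qed.

Lemma tp_farD q g m x y : tp_far q g m (x + L%:num) y = tp_far q g m x y /\
  tp_far q g m x (y + L%:num) = tp_far q g m x y.
Proof. by have [h1 h2] := tp_integrandD q g x y; rewrite /tp_far h1 h2 !curve_periodic. Qed.

(** Where the cutoff is not 0 the chord exceeds 1 / m, and the quotient is at most 2 divided by the
    chord. *)
Lemma tp_far_bounded q g m x y : 0 <= q -> tp_far q g m x y <= (2 * m%:R) `^ q.
Proof.
move=> q0; have [h|h] := leP (m%:R * enorm (g y - g x)) 1.
  by rewrite /tp_far cutoff_eq0// mulr0 powR_ge0.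
apply: (le_trans (tp_far_le q g m x y)).
have t1 := curve_arclength g x.
apply: ge0_ler_powR => //; rewrite ?nnegrE; [exact: tp_quotient_ge0|by rewrite mulr_ge0|].
apply: (le_trans (tp_quotient_le _ _ t1)); rewrite enormB.
have r0 : 0 < enorm (g y - g x).
  rewrite lt_neqAle enorm_ge0 andbT eq_sym; apply/eqP => r0.
  by move: h; rewrite r0 mulr0 ltr10.
by rewrite ler_pdivrMr// -mulrA ler_peMr// ltW.
Qed.

Lemma measurable_cutoff_chord g m :
  measurable_fun setT (fun z : R * R => cutoff m (enorm (g z.2 - g z.1))).
Proof.
apply: (@measurableT_comp _ _ _ _ _ _ (cutoff m) _ (fun z : R * R => enorm (g z.2 - g z.1))).
  by apply: continuous_measurable_fun; exact: continuous_cutoff.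
by apply: measurable_chord; exact: C1ia_continuous.
Qed.

Lemma measurable_tp_far q g m : measurable_fun setT (fun z : R * R => tp_far q g m z.1 z.2).
Proof.
apply: measurable_funM; first exact: measurable_tp_integrand.
exact: measurable_cutoff_chord.
Qed.

Lemma measurable_tp_near q g m : measurable_fun setT (fun z : R * R => tp_near q g m z.1 z.2).
Proof.
apply: measurable_funM; first exact: measurable_tp_integrand.
by apply: measurable_funB; [exact: measurable_cst|exact: measurable_cutoff_chord].
Qed.

(** Off the diagonal modulo L both factors converge; on it the cutoff is 0 as soon as the chords are
    short, whatever the integrand does. *)
Lemma cvg_tp_far q g m (X Y : nat -> R) x y : 0 < q ->
  X @ \oo --> x -> Y @ \oo --> y ->
  tp_far q g m (X n) (Y n) @[n --> \oo] --> tp_far q g m x y.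
Proof.
move=> q0 Xx Yy.
have gX : g (X n) @[n --> \oo] --> g x by exact: (cvg_comp _ _ Xx (@C1ia_continuous _ _ g x)).
have gY : g (Y n) @[n --> \oo] --> g y by exact: (cvg_comp _ _ Yy (@C1ia_continuous _ _ g y)).
have gYX : g (Y n) - g (X n) @[n --> \oo] --> g y - g x by exact: cvgB.
have ce : enorm (g (Y n) - g (X n)) @[n --> \oo] --> enorm (g y - g x) by exact: cvg_enorm.
have [gxy|gxy] := pselect (g x = g y); last first.
  have cc := cvg_comp _ _ ce (@continuous_cutoff m _).
  apply: cvgM; last exact: cc.
  by apply: (@cvg_tp_integrand R L q (fun=> g) g X Y x y) => //; exact: cvg_cst.
rewrite gxy (subrr (g y)) enorm0 in ce.
rewrite {2}/tp_far gxy (subrr (g y)) enorm0 cutoff_eq0 ?mulr0//.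
apply/cvgrPdist_le => e e0.
(* m + 1 instead of m keeps the threshold meaningful for m = 0. *)
have m0 : 0 < (m.+1%:R^-1 : R) by rewrite invr_gt0 ltr0n.
move/cvgrPdist_le : ce => /(_ _ m0); apply: filterS => n.
rewrite sub0r normrN ger0_norm ?enorm_ge0// => h.
rewrite /tp_far cutoff_eq0; first by rewrite mulr0 subrr normr0 ltW.
apply: (@le_trans _ _ (m.+1%:R * enorm (g (Y n) - g (X n)))).
  by rewrite ler_wpM2r ?enorm_ge0// ler_nat.
by rewrite mulrC -ler_pdivlMr ?ltr0n// mul1r.
Qed.

(** The sums are integrals of step functions that converge pointwise and are dominated by the
    constant [M] on a square of finite measure. Indexing by n + 1 avoids the empty partition. *)
Lemma riemann_sum_cvg (G : R -> R -> R) (M a : R) (s_ : nat -> nat -> R) :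
  (forall x y, 0 <= G x y <= M) ->
  (forall x y, G (x + L%:num) y = G x y /\ G x (y + L%:num) = G x y) ->
  measurable_fun setT (fun z : R * R => G z.1 z.2) ->
  (forall (X Y : nat -> R) x y, X @ \oo --> x -> Y @ \oo --> y ->
     G (X n) (Y n) @[n --> \oo] --> G x y) ->
  0 < a -> (forall n, cyclic_partition L n.+1 (s_ n)) ->
  (forall n i, (i < n.+1)%N -> s_ n i.+1 - s_ n i <= a / n.+1%:R) ->
  (\sum_(i < n.+1) \sum_(j < n.+1) G (s_ n j) (s_ n i) *
      (s_ n i.+1 - s_ n i) * (s_ n j.+1 - s_ n j))%:E @[n --> \oo] -->
  (\int[mu \x mu]_(z in DD) (G z.1 z.2)%:E)%E.
Proof.
move=> G0 pG mG cG a0 ps se; have mDD := @measurable_DD R L.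
pose st n z := step_fun L n.+1 (s_ n) (fun i j => G (s_ n j) (s_ n i)) z.
have near n z : DD z -> exists X Y, [/\ `|z.1 - X| <= a / n.+1%:R,
    `|z.2 - Y| <= a / n.+1%:R & st n z = G X Y].
  exact: (step_fun_near (ps n) (se n) pG).
have E n : (\int[mu \x mu]_(z in DD) (st n z)%:E)%E =
    (\sum_(i < n.+1) \sum_(j < n.+1) G (s_ n j) (s_ n i) *
      (s_ n i.+1 - s_ n i) * (s_ n j.+1 - s_ n j))%:E.
  by rewrite integral_step_fun// => i j; case/andP: (G0 (s_ n j) (s_ n i)).
under eq_fun do rewrite -E.
have [|||||_ _ H] := @dominated_convergence _ _ R (mu \x mu)%E DD mDD
  (fun n z => (st n z)%:E) (fun z => (G z.1 z.2)%:E) (cst M%:E).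
- by move=> n; apply/measurable_EFinP; exact: measurable_step_fun.
- exact/measurable_EFinP/measurable_funTS.
- apply/aeW => z Dz; apply/cvg_EFin; first by near=> n.
  have /choice[XY HXY] : forall n, exists XY : R * R, [/\ `|z.1 - XY.1| <= a / n.+1%:R,
      `|z.2 - XY.2| <= a / n.+1%:R & st n z = G XY.1 XY.2].
    by move=> n; have [X [Y H]] := near n z Dz; exists (X, Y).
  have cX : (XY n).1 @[n --> \oo] --> z.1.
    by apply: (cvg_of_mesh (k := S) a0) => // n; have [] := HXY n.
  have cY : (XY n).2 @[n --> \oo] --> z.2.
    by apply: (cvg_of_mesh (k := S) a0) => // n; have [] := HXY n.
  rewrite (_ : fine \o _ = fun n => G (XY n).1 (XY n).2); first exact: cG.
  by apply/funext => n /=; have [_ _ ->] := HXY n.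
- apply/integrableP; split; first exact: measurable_cst.
  rewrite (_ : (fun z => _) = cst `|M%:E|%E)// integral_cst//.
  rewrite [X in (_ * X < _)%E](_ : _ = (L%:num * L%:num)%:E).
    by rewrite /= -EFinM ltry.
  transitivity (mu `[0%R, L%:num[%classic * mu `[0%R, L%:num[%classic)%E.
    by apply: product_measure1E; exact: measurable_itv.
  have -> : mu `[0%R, L%:num[%classic = (L%:num)%:E.
    by rewrite lebesgue_measure_itv/= lte_fin gt0 -EFinB subr0.
  by rewrite -EFinM.
- apply/aeW => z n Dz; have [X [Y [_ _ ->]]] := near n z Dz.
  have /andP[h1 h2] := G0 X Y.
  by rewrite abse_EFin lee_fin ger0_norm.
- exact: H.
Unshelve. all: by end_near. Qed.

End limsup_tools.

(** * Choice of samples and the recovery sequence *)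

Section recovery.
Context {R : realType} {L : {posnum R}}.
Implicit Types (g : C1ia L) (s : nat -> R) (q e r : R) (m n : nat).

Notation mu := (@lebesgue_measure R).
Notation D := (`[0%R, L%:num[%classic : set R).
Notation DD := (`[0%R, L%:num[%classic `*` `[0%R, L%:num[%classic : set (R * R)).

Lemma integral_swap (Phi : R * R -> \bar R) (A : set R) : measurable A ->
  measurable_fun setT Phi -> (forall z, 0 <= Phi z)%E ->
  (\int[mu \x mu]_(z in A `*` A) Phi (z.2, z.1) =
   \int[mu \x mu]_(z in A `*` A) Phi z)%E.
Proof.
move=> mA mP P0; have mAA : measurable (A `*` A) by exact: measurableX.
pose f := Phi \_ (A `*` A).
have mf : measurable_fun setT f.
  by apply/(measurable_restrictT _ _).1 => //; exact: measurable_funTS.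
have f0 z : (0 <= f z)%E by exact: erestrict_ge0.
have msw : measurable_fun setT (fun z : R * R => (z.2, z.1)).
  by apply/measurable_fun_pairP; split; [exact: measurable_snd|exact: measurable_fst].
have mf' : measurable_fun setT (fun z : R * R => f (z.2, z.1)).
  exact: (measurableT_comp mf msw).
rewrite integral_mkcond [RHS]integral_mkcond -/f.
rewrite (_ : (_ \_ _) = (fun z : R * R => f (z.2, z.1))); last first.
  apply/funext => -[x y]; rewrite /f !patchE /=.
  by congr (if _ then _ else _); apply/idP/idP => /set_mem[? ?]; exact/mem_set.
apply: eq_trans (fubini_tonelli2 (m1 := mu) (m2 := mu) _ mf' (fun z => f0 _)) _.
exact/esym/(fubini_tonelli1 (m1 := mu) (m2 := mu) f mf f0).
Qed.

(** Folds the square onto the pairs j < i, which are those that the averaging argument controls. *)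
Lemma sum_symmetrize (a : nat -> nat -> R) n : (forall i, a i i = 0) ->
  \sum_(i < n) \sum_(j < n) a i j = \sum_(i < n) \sum_(j < i) (a i j + a j i).
Proof.
move=> a0; elim: n => [|n IH]; first by rewrite !big_ord0.
rewrite [RHS]big_ord_recr/= -IH big_ord_recr/=.
under eq_bigr do rewrite big_ord_recr/=.
by rewrite !big_split/= big_ord_recr/= a0 addr0 -addrA; congr (_ + _); rewrite addrC.
Qed.

(** Dominated convergence: the integrand itself is an integrable bound because the energy is finite.
    The near part is 0 on the diagonal, and off it the cutoff is eventually 1. *)
Lemma tp_near_integral q g : 0 < q -> (TP q g < +oo)%E -> forall e, 0 < e -> exists m,
  (\int[mu \x mu]_(z in DD) (tp_near q g m z.1 z.2)%:E <= e%:E)%E.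
Proof.
move=> q0 TPfin e e0; have mDD := @measurable_DD R L.
have [|||||_ _ H] := @dominated_convergence _ _ R (mu \x mu)%E DD mDD
  (fun m z => (tp_near q g m z.1 z.2)%:E) (cst 0%E)
  (fun z => (tp_integrand q g z.1 z.2)%:E).
- by move=> m; apply/measurable_EFinP/measurable_funTS; exact: measurable_tp_near.
- exact: measurable_cst.
- apply/aeW => z Dz; apply/cvg_EFin; first by near=> m.
  apply/cvgrPdist_le => d d0.
  have [gz|gz] := pselect (g z.1 = g z.2).
    have [/=] := Dz; rewrite !in_itv/= => z1 z2.
    apply: nearW => m /=; rewrite /tp_near (C1ia_injective0 z1 z2 gz).
    by rewrite tp_integrand_diag ?gt_eqF// mul0r subrr normr0 ltW.
  have r0 : 0 < enorm (g z.2 - g z.1).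
    by apply: enorm_gt0 => /subr0_eq /esym.
  have [N HN] := mesh_small (ltr0Sn R 1) r0; exists N => // m /= Nm.
  have [m0 h] := HN m Nm; rewrite /tp_near cutoff_eq1 ?subrr ?mulr0 ?subr0 ?normr0 ?(ltW d0)//.
  by rewrite mulrC -ler_pdivrMr// ltr0n.
- apply/integrableP; split.
    by apply/measurable_EFinP/measurable_funTS; exact: measurable_tp_integrand.
  apply: le_lt_trans TPfin; rewrite /TP le_eqVlt; apply/orP; left; apply/eqP.
  by apply: eq_integral => z _; rewrite abse_EFin ger0_norm// tp_integrand_ge0.
- apply/aeW => z m Dz; rewrite abse_EFin lee_fin ger0_norm ?tp_near_ge0//.
  exact: tp_near_le.
rewrite integral0 in H; move/fine_cvgP : H => [Hf /cvgrPdist_le/(_ _ e0) Hc].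
have [m [h1 h2]] := filter_ex (filterI Hf Hc); exists m.
move: h1 h2 => /= h1; rewrite sub0r normrN => /(le_trans (ler_norm _)).
by rewrite -lee_fin fineK.
Unshelve. all: by end_near. Qed.

(** 75 is 25 times 3: the weight of a pair is at most (5h/4)^2, which is 25 times the (h/4)^2 of the
    averaging argument; 3e is e for each order of a pair plus e of slack. *)
Lemma sampling q g m n e : 0 < q -> (0 < n)%N -> 0 < e ->
  (\int[mu \x mu]_(z in DD) (tp_near q g m z.1 z.2)%:E <= e%:E)%E ->
  exists s, [/\ s n = s 0%N + L%:num,
    forall i, (i < n)%N -> 3 / 4 * (L%:num / n%:R) <= s i.+1 - s i <= 5 / 4 * (L%:num / n%:R) &
    \sum_(i < n) \sum_(j < n) tp_near q g m (s j) (s i) *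
      (s i.+1 - s i) * (s j.+1 - s j) <= 75 * e].
Proof.
move=> q0 n0 e0 He; set h := L%:num / n%:R.
have nR : 0 < n%:R :> R by rewrite ltr0n.
have h0 : 0 < h by rewrite divr_gt0.
have nh : n%:R * h = L%:num by rewrite /h mulrC divfK// gt_eqF.
(* Staying in the first quarter of each interval keeps consecutive samples between 3/4 h and 5/4 h
   apart. *)
pose I i : set R := `[i%:R * h, i%:R * h + h / 4[%classic.
pose Phi (z : R * R) := (tp_near q g m z.1 z.2 + tp_near q g m z.2 z.1)%:E.
have mN := @measurable_tp_near R L q g m.
have mP : measurable_fun setT (fun z : R * R => (tp_near q g m z.1 z.2)%:E).
  exact/measurable_EFinP.
have msw : measurable_fun setT (fun z : R * R => (z.2, z.1)).
  by apply/measurable_fun_pairP; split; [exact: measurable_snd|exact: measurable_fst].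
have mP' : measurable_fun setT (fun z : R * R => (tp_near q g m z.2 z.1)%:E).
  exact: (measurableT_comp mP msw).
have mPhi : measurable_fun setT Phi by exact: emeasurable_funD mP mP'.
have Phi0 z : (0 <= Phi z)%E by rewrite lee_fin addr_ge0 ?tp_near_ge0.
have c0 : 0 < h / 4 by rewrite divr_gt0.
have succ (i j : nat) : (i < j)%N -> i%:R * h + h <= j%:R * h.
  by move=> ij; rewrite -[X in _ + X]mul1r -mulrDl ler_pM2r// natr1 ler_nat.
have mI i : measurable (I i) by exact: measurable_itv.
have Ic i : mu (I i) = (h / 4)%:E.
  rewrite lebesgue_measure_itv/= lte_fin ltrDl c0 -EFinB.
  by rewrite [_ + h / 4]addrC addrK.
have ID i : (i < n)%N -> I i `<=` D.
  move=> /succ; rewrite nh => ih x; rewrite /I /= !in_itv/= => /andP[x1 x2].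
  apply/andP; split; last by lra.
  by apply: le_trans x1; rewrite mulr_ge0// ltW.
have tI : trivIset setT I.
  apply/trivIsetP => i j _ _ ij; apply/seteqP; split=> // x [].
  rewrite /I /= !in_itv/= => /andP[x1 x2] /andP[x3 x4].
  by case: (ltngtP i j) ij => // /succ h1 _; lra.
have [x [xI Hx]] := exists_le_pair_integral mPhi Phi0 c0 e0 mI Ic (measurable_itv _) ID tI.
have HP : (\int[mu \x mu]_(z in DD) Phi z <= (e + e)%:E)%E.
  apply: (@le_trans _ _ (\int[mu \x mu]_(z in DD) (tp_near q g m z.1 z.2)%:E +
      \int[mu \x mu]_(z in DD) (tp_near q g m z.2 z.1)%:E)%E).
    have mDD := @measurable_DD R L.
    rewrite le_eqVlt; apply/orP; left; apply/eqP.
    apply: (@ge0_integralD _ _ R (mu \x mu)%E DD mDD (fun z => (tp_near q g m z.1 z.2)%:E)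
      (fun z => (tp_near q g m z.2 z.1)%:E)).
    - by move=> z _; rewrite lee_fin tp_near_ge0.
    - exact: measurable_funTS mP.
    - by move=> z _; rewrite lee_fin tp_near_ge0.
    - exact: measurable_funTS mP'.
  rewrite EFinD; apply: leeD => //; apply: le_trans He.
  rewrite le_eqVlt; apply/orP; left; apply/eqP.
  apply: (@integral_swap (fun z => (tp_near q g m z.1 z.2)%:E)) => //.
  by move=> z; rewrite lee_fin tp_near_ge0.
have {}Hx : (\sum_(i < n) \sum_(j < i) ((h / 4) ^+ 2)%:E * Phi (x j, x i) <= (3 * e)%:E)%E.
  apply: (le_trans Hx); have -> : 3 * e = e + e + e by ring.
  by rewrite EFinD; apply: leeD.
(* Past the last sample the sequence closes up with the first one, one period on. *)
pose s i := if (i < n)%N then x i else x 0%N + L%:num.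
have sx i : (i < n)%N -> s i = x i by rewrite /s => ->.
have xb i : (i < n)%N -> i%:R * h <= x i < i%:R * h + h / 4.
  by move=> /xI; rewrite /I /= in_itv.
have sn : s n = s 0%N + L%:num by rewrite /s ltnn n0.
have sb i : (i <= n)%N -> i%:R * h <= s i < i%:R * h + h / 4.
  rewrite leq_eqVlt => /orP[/eqP->|ni]; last by rewrite sx// xb.
  have := xb 0%N n0; rewrite sn sx// mul0r add0r nh => /andP[h1 h2].
  by apply/andP; split; lra.
have sd i : (i < n)%N -> 3 / 4 * h <= s i.+1 - s i <= 5 / 4 * h.
  move=> ni; have /andP[h1 h2] := sb i (ltnW ni); have /andP[h3 h4] := sb i.+1 ni.
  rewrite -natr1 mulrDl mul1r in h3 h4.
  by apply/andP; split; lra.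
exists s; split=> //.
pose a i j := tp_near q g m (s j) (s i).
have a0 i : a i i = 0 by rewrite /a /tp_near tp_integrand_diag ?gt_eqF// mul0r.
apply: (@le_trans _ _ (25 * (\sum_(i < n) \sum_(j < n) (h / 4) ^+ 2 * a i j))).
  rewrite mulr_sumr; apply: ler_sum => i _; rewrite mulr_sumr; apply: ler_sum => j _.
  have /andP[h1 h2] := sd i (ltn_ord i); have /andP[h3 h4] := sd j (ltn_ord j).
  have -> : 25 * ((h / 4) ^+ 2 * a i j) = a i j * (5 / 4 * h) * (5 / 4 * h) by field.
  have t0 : 0 <= a i j by exact: tp_near_ge0.
  have d0 : 0 <= s i.+1 - s i by apply: le_trans h1; rewrite mulr_ge0// ltW.
  have d1 : 0 <= s j.+1 - s j by apply: le_trans h3; rewrite mulr_ge0// ltW.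
  by apply: ler_pM => //; [rewrite mulr_ge0|apply: ler_pM].
have -> : 75 * e = 25 * (3 * e) by ring.
rewrite ler_pM2l//.
rewrite (@sum_symmetrize (fun i j => (h / 4) ^+ 2 * a i j)); last by move=> i; rewrite a0 mulr0.
rewrite -lee_fin; apply: le_trans Hx; rewrite -sumEFin; apply: lee_sum => i _.
rewrite -sumEFin; apply: lee_sum => j _.
rewrite /Phi -EFinM lee_fin mulrDr /a /= !sx//.
exact: ltn_trans (ltn_ord j) (ltn_ord i).
Qed.

Lemma discrete_TP_approx q g e : 0 < q -> (TP q g < +oo)%E -> 0 < e ->
  exists N, forall n, (N <= n)%N -> exists h : C1ia L,
    C1dist h g <= e /\ (discrete_TP q n h <= TP q g + e%:E)%E.
Proof.
move=> q0 TPfin e0; have qn0 : q != 0 by rewrite gt_eqF.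
have mDD := @measurable_DD R L.
have TP0 : (0 <= TP q g)%E.
  by apply: integral_ge0 => z _; rewrite lee_fin tp_integrand_ge0.
have TPf : TP q g \is a fin_num by rewrite ge0_fin_numE.
set t := fine (TP q g); have t0 : 0 <= t by exact: fine_ge0.
have tE : TP q g = t%:E by rewrite fineK.
(* The budget: (1 + d)(t + 76 d) <= t + e as soon as d <= 1 and d (t + 152) <= e; here 76 is 75 from
   the near part plus 1 from the Riemann sum of the far part. *)
have a0 : 0 < e / (t + 152) by rewrite divr_gt0// ltr_wpDl.
have [d [d0 d1 de dt _]] := small4 ltr01 e0 a0 ltr01.
have [m Hm] := tp_near_integral q0 TPfin d0.
have /choice[s_ Hs] n := sampling q0 (ltn0Sn n) d0 Hm.
have L0 : 0 < L%:num :> R by [].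
have ps n : cyclic_partition L n.+1 (s_ n).
  have [sn sI _] := Hs n; split=> // i /sI/andP[h _].
  by rewrite -subr_gt0 (lt_le_trans _ h)// mulr_gt0// divr_gt0// ltr0n.
have se n i : (i < n.+1)%N -> s_ n i.+1 - s_ n i <= 5 / 4 * L%:num / n.+1%:R.
  by have [_ sI _] := Hs n; move=> /sI/andP[_]; rewrite mulrA.
have aL : 0 < 5 / 4 * L%:num by rewrite mulr_gt0.
have H := riemann_sum_cvg (fun x y => introT andP (conj (tp_far_ge0 q g m x y)
    (tp_far_bounded g m x y (ltW q0)))) (tp_farD q g m) (measurable_tp_far q g m)
  (fun X Y x y => @cvg_tp_far R L q g m X Y x y q0) aL ps se.
have far_le : (\int[mu \x mu]_(z in DD) (tp_far q g m z.1 z.2)%:E <= t%:E)%E.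
  rewrite -tE /TP; apply: ge0_le_integral => //.
  - by move=> z _; rewrite lee_fin tp_far_ge0.
  - by apply/measurable_EFinP/measurable_funTS; exact: measurable_tp_far.
  - by apply/measurable_EFinP/measurable_funTS; exact: measurable_tp_integrand.
  - by move=> z _; rewrite lee_fin; exact: tp_far_le.
have far0 : (0 <= \int[mu \x mu]_(z in DD) (tp_far q g m z.1 z.2)%:E)%E.
  by apply: integral_ge0 => z _; rewrite lee_fin tp_far_ge0.
move: H far_le far0; case: (\int[mu \x mu]_(z in DD) (tp_far q g m z.1 z.2)%:E)%E => // r H.
rewrite !lee_fin => rt r0.
move/fine_cvgP : H => [_ /cvgrPdist_le/(_ _ d0)[N1 _ HN1]].
have [N2 HN2] := biarc_interpolation g (ltW q0) d0.
exists (maxn N1 N2).+1 => -[//|n]; rewrite ltnS geq_max => /andP[n1 n2].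
have [sn sI near] := Hs n.
have [h [rr [hB hd hs]]] := HN2 n.+1 (s_ n) (leqW n2) sn sI.
exists h; split; first exact: le_trans hd de.
apply: (@le_trans _ _ (discrete_sum q n.+1 h rr)%:E).
  by apply: ereal_inf_lbound; exists rr.
rewrite tE -EFinD lee_fin (le_trans hs)//.
have -> : discrete_sum q n.+1 g (s_ n) =
    \sum_(i < n.+1) \sum_(j < n.+1) tp_far q g m (s_ n j) (s_ n i) *
      (s_ n i.+1 - s_ n i) * (s_ n j.+1 - s_ n j) +
    \sum_(i < n.+1) \sum_(j < n.+1) tp_near q g m (s_ n j) (s_ n i) *
      (s_ n i.+1 - s_ n i) * (s_ n j.+1 - s_ n j).
  rewrite discrete_sumE// -big_split; apply: eq_bigr => i _ /=.
  rewrite -big_split; apply: eq_bigr => j _ /=.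
  by rewrite (tp_far_near q g m) !mulrDl.
have := HN1 n n1; rewrite /= ler_norml => /andP[far _].
move: far near; set S1 := \sum_(i < n.+1) _; set S2 := \sum_(i < n.+1) _ => far near.
clearbody S1 S2.
have h1 : S1 + S2 <= t + 76 * d by lra.
have h2 : (1 + d) * (S2 + S1) <= (1 + d) * (t + 76 * d).
  by rewrite ler_pM2l; lra.
apply: (le_trans h2); rewrite ler_pdivlMr in dt; last by rewrite ltr_wpDl.
have : d * d <= d by rewrite ler_piMr// ltW.
by clear -dt t0 d0; lra.
Qed.

(** Each accuracy comes with its own curves; one sequence is obtained by requiring of the n-th curve
    the best accuracy attainable at n. *)
Lemma discrete_TP_recovery q g : 0 < q -> exists h_ : nat -> C1ia L,
  h_ @ \oo --> g /\ (limn_esup (fun n => discrete_TP q n (h_ n)) <= TP q g)%E.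
Proof.
move=> q0; have [TPoo|TPfin] := eqVneq (TP q g) +oo%E.
  by exists (fun=> g); split; [exact: cvg_cst|rewrite TPoo leey].
rewrite -ltey in TPfin.
pose P n k h := C1dist h g <= (k.+1%:R^-1 : R) /\
  (discrete_TP q n h <= TP q g + (k.+1%:R^-1)%:E)%E.
have mono n k k' h : (k <= k')%N -> P n k' h -> P n k h.
  move=> kk [h1 h2]; have kR : (k'.+1%:R^-1 : R) <= k.+1%:R^-1.
    by rewrite lef_pV2 ?posrE ?ltr0n// ler_nat.
  by split; [exact: le_trans h1 kR|apply: (le_trans h2); rewrite leeD2l// lee_fin].
(* Accuracy levels are nested, so a curve for the highest attainable level below K serves all lower
   ones; bounding the levels makes a highest one exist. *)
have best n K : exists h, forall k, (k < K)%N -> (exists h, P n k h) -> P n k h.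
  elim: K => [|K [h Hh]]; first by exists g.
  have [[h' Ph']|nP] := pselect (exists h, P n K h).
    by exists h' => k kK _; apply: mono Ph'; rewrite -ltnS.
  exists h => k; rewrite ltnS leq_eqVlt => /orP[/eqP->//|kK]; exact: Hh.
have /choice[h_ Hh] n := best n n.
have ev k : exists N, forall n, (N <= n)%N -> P n k (h_ n).
  have k0 : 0 < (k.+1%:R^-1 : R) by rewrite invr_gt0 ltr0n.
  have [N HN] := discrete_TP_approx q0 TPfin k0.
  exists (maxn N k.+1) => n; rewrite geq_max => /andP[Nn kn].
  by apply: Hh => //; have [h ?] := HN n Nn; exists h.
have small e : 0 < e -> exists k : nat, (k.+1%:R^-1 : R) <= e.
  move=> e0; have [N HN] := mesh_small ltr01 e0; exists N.
  by have [_] := HN N.+1 (leqnSn N); rewrite div1r.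
exists h_; split.
  apply/cvg_ballP => e e0; have e20 : 0 < e / 2 by rewrite divr_gt0.
  have [k ke] := small _ e20; have [N HN] := ev k.
  exists N => // n /= Nn; have [h1 _] := HN n Nn.
  suff : C1dist g (h_ n) < e by [].
  rewrite C1dist_sym.
  by apply: (le_lt_trans (le_trans h1 ke)); lra.
apply/lee_addgt0Pr => e e0; apply: limn_esup_le.
have [k ke] := small _ e0; have [N HN] := ev k; exists N => n Nn.
have [_ h2] := HN n Nn; apply: (le_trans h2).
by rewrite leeD2l// lee_fin.
Qed.

End recovery.

Unset Implicit Arguments.

Theorem theorem1p1 (R : realType) (q : R) (L : {posnum R}) (hq : 2 < q) :
  Gamma_converges (fun (n : nat) (g : C1ia L) => discrete_TP q n g)
                  (fun g : C1ia L => TP q g).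
Proof.
have q0 : 0 < q by rewrite (lt_trans _ hq).
split=> [h_ g hg|g]; first exact: discrete_TP_liminf.
exact: discrete_TP_recovery.
Qed.
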